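(* Let $\Gamma$ be a countable discrete group, and let $\mu$ be an admissible finitely supported lazy probability measure on $\Gamma$. Then the minimal space-time Martin boundary is homeomorphic to the disjoint union of the minimal $\lambda$-Martin boundaries for $\lambda\in[0,R]$: $$\partial^m_{ST}\Gamma\;\cong\;\bigsqcup_{\lambda\in[0,R]}\partial^m_{M,\lambda}\Gamma,$$ where the right-hand side carries its natural topology of pointwise convergence, in which a sequence $(\lambda_n,\xi_n)$ converges to $(\lambda,\xi)$ if and only if $\lambda_n\to\lambda$ and $\tilde K(x,\xi_n\,|\,\lambda_n)\to\tilde K(x,\xi\,|\,\lambda)$ for every $x\in\Gamma$.
   Context: Random walk: $e$ is the identity of $\Gamma$, $P(x,y)=\mu(x^{-1}y)$, $P^n(x,y)=\mu^{*n}(x^{-1}y)$ (with $P^0(x,y)=\delta_{x,y}$). $\mu$ is admissible if its support generates $\Gamma$ as a semigroup, and lazy if $\mu(e)>0$. $R=(\limsup_nP^n(x,y)^{1/n})^{-1}$ (independent of $x,y$). $|x|=\inf\{n\ge0:P^n(e,x)>0\}$. By a Martin compactification of a countable set $\Omega$ with respect to kernels $K(x,\cdot)$, $x\in\Omega$, is meant the smallest compactification of $\Omega$ (compact Hausdorff, containing $\Omega$ as a discrete, open, dense subset) to which all functions $y\mapsto K(x,y)$ extend continuously; the extensions are still denoted $K(x,\xi)$, and the Martin boundary is the complement of $\Omega$. $\lambda$-Martin boundary, $0<\lambda\le R$: $G(x,y\,|\,\lambda)=\sum_{n\ge0}\lambda^nP^n(x,y)$; $K(x,y\,|\,\lambda)=G(x,y\,|\,\lambda)/G(e,y\,|\,\lambda)$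 for $0<\lambda<R$, and $K(x,y\,|\,R)=\lim_{\lambda\to R}K(x,y\,|\,\lambda)$. $\partial_{M,\lambda}\Gamma$ is the Martin boundary of $\Gamma$ for these kernels. A function $h$ on $\Gamma$ is $\lambda^{-1}$-harmonic if $\sum_yP(x,y)h(y)=\lambda^{-1}h(x)$ for all $x$. A non-negative $\lambda^{-1}$-harmonic $h$ with $h(e)=1$ is minimal if every non-negative $\lambda^{-1}$-harmonic $g$ with $g\le Ch$ for some $C>0$ is a constant multiple of $h$. $\partial^m_{M,\lambda}\Gamma$ is the set of $\xi\in\partial_{M,\lambda}\Gamma$ such that $K(\cdot,\xi\,|\,\lambda)$ is minimal $\lambda^{-1}$-harmonic. $0$-Martin boundary: let $\bar\mu_x(y)=\mu(x^{-1}y)$ if $|y|\ge|x|+1$ and $\bar\mu_x(y)=0$ otherwise. The $0$-Martin kernel is $K(x,y\,|\,0)=P^{|y|-|x|}(x,y)/P^{|y|}(e,y)$ if $|y|=|x|+|x^{-1}y|$, and $0$ otherwise. $\partial_{M,0}\Gamma$ is the Martin boundary of $\Gamma$ for these kernels. A function $h$ is $\infty$-harmonic if $h(x)=\sum_y\bar\mu_x(y)h(y)$ for all $x$. A non-negative $\infty$-harmonic $h$ with $h(e)=1$ is minimal if every non-negative $\infty$-harmonic $g$ with $g\le Ch$ for some $C>0$ is a constant multiple of $h$. $\partial^m_{M,0}\Gamma$ is the set of $\xi\in\partial_{M,0}\Gamma$ such that $K(\cdot,\xi\,|\,0)$ is minimal $\infty$-harmonic. Rescaled kernels: $\tilde K(x,\xi\,|\,\lambda)=\lambda^{|x|}K(x,\xi\,|\,\lambda)$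 for $\lambda>0$, and $\tilde K(x,\xi\,|\,0)=K(x,\xi\,|\,0)$. Space-time boundary: $ST=\{(x,n)\in\Gamma\times\mathbb Z_{\ge0}:P^n(e,x)>0\}$ with Markov kernel $P_{ST}((x,m),(y,n))=\delta_{m+1,n}\,\mu(x^{-1}y)$. Its Martin kernels (base point $(e,0)$) are $K_{ST}((x,m),(y,n))=P^{n-m}(x,y)/P^n(e,y)$ if $n\ge m$, and $0$ otherwise. $\partial_{ST}\Gamma$ is the Martin boundary of $ST$ for these kernels. A function $f$ on $ST$ is space-time harmonic if $P_{ST}f=f$; a non-negative space-time harmonic $f$ with $f((e,0))=1$ is minimal if every non-negative space-time harmonic $g$ with $g\le Cf$ for some $C>0$ is a constant multiple of $f$. $\partial^m_{ST}\Gamma$ is the set of $\eta\in\partial_{ST}\Gamma$ such that $K_{ST}(\cdot,\eta)$ is minimal space-time harmonic, with the subspace topology.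
   Formalization: The group Γ is assumed countably infinite; for finite Γ the claim fails, since all λ-Martin boundaries are then empty while the minimal space-time boundary is a single point. *)

(* Defs.v *)
From HB Require Import structures.
From mathcomp Require Import all_boot all_order all_algebra.
From mathcomp Require Import all_classical all_reals all_analysis.
Import Order.TTheory GRing.Theory Num.Theory.
Import numFieldNormedType.Exports.

Set Implicit Arguments.
Unset Strict Implicit.
Unset Printing Implicit Defensive.

Local Open Scope classical_set_scope.
Local Open Scope ring_scope.

Definition homeomorphic (X Y : topologicalType) : Prop :=
  exists (f : X -> Y) (g : Y -> X),
    [/\ cancel f g, cancel g f, continuous f & continuous g].

Record compactification (Omega : Type) := Compactification {
  cspace :> topologicalType;
  cembed : Omega -> cspace;
  cspace_compact : compact [set: cspace];
  cspace_hausdorff : hausdorff_space cspace;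
  cembed_inj : injective cembed;
  cembed_open : forall y, open [set cembed y];
  cembed_dense : dense (range cembed)
}.
Arguments cembed {Omega} c y.

Section MartinCompactification.
Context {R : realType} {Omega : Type}.
Implicit Types (C : compactification Omega) (f : Omega -> R).

Definition continuous_extension C f (F : C -> R) : Prop :=
  continuous F /\ forall y, F (cembed C y) = f y.

Arguments continuous_extension C f F : clear implicits.

(* Such an F is unique, since the range of cembed is dense. *)
Definition extension C f : C -> R :=
  xget (fun=> 0) [set F | continuous_extension C f F].
Arguments extension C f : clear implicits.

Definition is_martin_compactification (K : Omega -> Omega -> R) C : Prop :=
  (forall x, exists F, continuous_extension C (K x) F) /\
  (forall C' : compactification Omega,
     (forall x, exists F, continuous_extension C' (K x) F) ->
     exists h : C' -> C,
       continuous h /\ forall y, h (cembed C' y) = cembed C y).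

Definition martin_boundary C : set C := ~` range (cembed C).
Arguments martin_boundary C : clear implicits.

Definition minimal_harmonic (harmonic : (Omega -> R) -> Prop) (o : Omega)
    (h : Omega -> R) : Prop :=
  [/\ harmonic h, forall x, 0 <= h x, h o = 1 &
      forall g : Omega -> R, harmonic g -> (forall x, 0 <= g x) ->
        (exists2 c : R, 0 < c & forall x, g x <= c * h x) ->
        exists c : R, forall x, g x = c * h x].

Definition minimal_boundary (K : Omega -> Omega -> R)
    (harmonic : (Omega -> R) -> Prop) (o : Omega) C : set C :=
  [set xi | martin_boundary C xi /\
            minimal_harmonic harmonic o (fun x => extension C (K x) xi)].
Arguments minimal_boundary K harmonic o C : clear implicits.

End MartinCompactification.
Arguments continuous_extension {R Omega} C f F.
Arguments extension {R Omega} C f _.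
Arguments martin_boundary {Omega} C.
Arguments minimal_boundary {R Omega} K harmonic o C.

Lemma cvg_ptwsP {R : realType} {T : choiceType}
    (F : set_system {ptws T -> R}) (f : {ptws T -> R}) : Filter F ->
  F --> f <-> forall t, (g t @[g --> F]) --> f t.
Proof.
move=> FF; split=> [Ff t|H].
  by have := @proj_continuous T (fun=> R) t f; apply: cvg_trans;
     exact: cvg_app Ff.
apply/cvg_sup => t; apply/cvg_image => [|].
  by rewrite eqEsubset; split => y // _; exists (fun=> y).
move=> A /H FA; exists (@^~ t @^-1` A) => //.
rewrite image_preimage //.
by rewrite eqEsubset; split => y // _; exists (fun=> y).
Qed.

Section MartinExistence.
Context {R : realType} {Omega : choiceType} (K : Omega -> Omega -> R).
Context (Kbd : forall x, exists M : R, forall y, `|K x y| <= M).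

Let Z := {ptws (Omega + Omega)%type -> R}.
Let phi (y : Omega) : Z :=
  fun i => match i with inl x => K x y | inr z => (z == y)%:R end.
Let clo : set Z := closure (range phi).
Let X : topologicalType := set_type clo.

Let phi_clo y : clo (phi y).
Proof. exact: (@subset_closure Z (range phi) (phi y) (imageT phi y)). Qed.

Let emb (y : Omega) : X := exist _ (phi y) (mem_set (@phi_clo y)).

Let val_cts : continuous (set_val : X -> Z).
Proof. exact: initial_continuous. Qed.

Let Zh : hausdorff_space Z.
Proof. by apply: (@hausdorff_product _ (fun=> R)) => _; exact: Rhausdorff. Qed.

Let coord_cts i : continuous (fun p : X => set_val p i).
Proof.
move=> p; apply: (@continuous_comp X Z R set_val (@^~ i)); first exact: val_cts.
exact: (@proj_continuous _ (fun=> R) i).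
Qed.

Let X_compact : compact [set: X].
Proof.
have [M HM] : exists M : Omega -> R, forall x y, `|K x y| <= M x.
  have [f fP] := @boolp.choice _ _
    (fun x (M : R) => forall y, `|K x y| <= M) Kbd.
  by exists f.
pose B (i : (Omega + Omega)%type) : set R := match i with
  inl x => `[- M x, M x]%classic | inr _ => `[0, 1]%classic end.
have Bc : compact [set f : Z | forall i, B i (f i)].
  by apply: (@tychonoff _ (fun=> R) B) => -[x|z]; exact: segment_compact.
have cloB : clo `<=` [set f : Z | forall i, B i (f i)].
  rewrite /clo closureE; apply: smallest_sub; first exact: compact_closed Zh Bc.
  move=> _ [y _ <-] [x|z] /=; rewrite in_itv /=;
    last by case: eqP => _ /=; rewrite ?lexx ?ler01.
  by rewrite -ler_norml.
have c : compact clo.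
  by apply: subclosed_compact Bc cloB; exact: closed_closure.
move=> F FF _.
have PF : ProperFilter (set_val @ F) by exact: fmap_proper_filter.
have [|z [cz zF]] := c (set_val @ F) PF.
  by apply: (@filterE _ F) => p; exact: set_valP.
exists (exist _ z (mem_set cz)); split => // A V FA.
rewrite nbhsE => -[_ [[W Wo <-] Wz] WV].
have [||q [[p Ap pq] Wq]] := zF (set_val @` A) W.
- by apply: (@filterS _ F _ A _ _ FA) => p Ap; exists p.
- exact: open_nbhs_nbhs.
- by exists p; split => //; apply: WV; rewrite /= pq.
Qed.

Let X_hausdorff : hausdorff_space X.
Proof.
move=> p q pq; apply: val_inj; apply: Zh => A B Ap Bq.
have [||r [Ar Br]] := pq (set_val @^-1` A) (set_val @^-1` B).
- exact: val_cts.
- exact: val_cts.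
by exists (set_val r).
Qed.

Let emb_inj : injective emb.
Proof.
move=> y z /(congr1 (fun p : X => set_val p (inr y))) /=.
rewrite !set_valE /= eqxx; case: eqP => // _ /eqP; by rewrite oner_eq0.
Qed.

Let X_point (y : Omega) (p : X) : set_val p (inr y) != 0 -> p = emb y.
Proof.
move=> py; apply: val_inj; apply: Zh => A B Ap Bq.
have pN : \forall q \near (set_val p : Z), q (inr y) != 0.
  have := @proj_continuous _ (fun=> R) (inr y : (Omega + Omega)%type)
    (set_val p) [set r | r != 0].
  apply; apply: open_nbhs_nbhs; split => //; exact: open_neq.
have [_ [[z _ <-] [/= Az]]] :=
  set_valP p (A `&` [set q | q (inr y) != 0]) (filterI Ap pN).
have [yz _|_] := eqVneq y z; last by rewrite eqxx.
exists (phi z); split => //; rewrite -yz.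
exact: nbhs_singleton Bq.
Qed.

Let emb_open (y : Omega) : open [set emb y].
Proof.
rewrite (_ : [set emb y] =
  (fun p : X => set_val p (inr y)) @^-1` [set r | r != 0]).
  by move/continuousP : (@coord_cts (inr y)); apply; exact: open_neq.
rewrite eqEsubset; split => [_ ->|p /X_point ->//] /=.
by rewrite set_valE /= eqxx oner_neq0.
Qed.

Let emb_dense : dense (range emb).
Proof.
move=> O [p Op] [W Wo We]; subst O; move: Op => /= Wp.
have [_ [[y _ <-] Wy]] := set_valP p W (open_nbhs_nbhs (conj Wo Wp)).
by exists (emb y); split => //; exists y.
Qed.

Let mc : compactification Omega :=
  Compactification X_compact X_hausdorff emb_inj emb_open emb_dense.

Lemma exists_martin_compactification :
  exists C : compactification Omega, is_martin_compactification K C.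
Proof.
exists mc; split => [x|C' C'K].
  by exists (fun p : X => set_val p (inl x)); split => //; exact: coord_cts.
have ind z : exists F, continuous_extension C' (fun y => (z == y)%:R : R) F.
  exists (fun q => (q == cembed C' z)%:R); split; last first.
    by move=> y; rewrite eq_sym (inj_eq (@cembed_inj _ C')).
  move=> q; have [->|qz] := eqVneq q (cembed C' z).
    apply: cvg_near_cst; rewrite eqxx.
    have := open_nbhs_nbhs (conj (@cembed_open _ C' z)
      (erefl _ : [set cembed C' z] (cembed C' z))).
    by apply: filterS => r ->; rewrite eqxx.
  apply: cvg_near_cst; rewrite (negbTE qz).
  have cl : closed [set cembed C' z].
    by apply: compact_closed; [exact: cspace_hausdorff|exact: compact_set1].
  have : open_nbhs q (~` [set cembed C' z]).
    by split; [exact: closed_openC|exact/eqP].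
  move/open_nbhs_nbhs; apply: filterS => r /eqP rz.
  by rewrite (negbTE rz).
have [F FP] := boolp.choice C'K.
have [G GP] := boolp.choice ind.
pose H (q : C') : Z := fun i =>
  match i with inl x => F x q | inr z => G z q end.
have Hc : continuous H.
  move=> q; apply/(@cvg_ptwsP R _ (H @ q)) => -[x|z].
    exact: (FP x).1.
  exact: (GP z).1.
have He y : H (cembed C' y) = phi y.
  by apply/funext => -[x|z] /=; rewrite ?(FP _).2 ?(GP _).2.
have Hclo q : clo (H q).
  move=> A /Hc /=; rewrite nbhsE => -[U [Uo Uq] UA].
  have [w [Up [y _ ye]]] := @cembed_dense _ C' U (ex_intro _ q Uq) Uo.
  exists (phi y); split; first by exists y.
  by rewrite -He; apply: UA; rewrite ye.
exists (fun q => exist _ (H q) (mem_set (Hclo q)) : X); split; last first.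
  by move=> y; apply: val_inj; rewrite /= He.
move=> q A; rewrite nbhsE => -[_ [[W Wo <-] Wz] WV].
move: (Hc q W (open_nbhs_nbhs (conj Wo Wz))) => HW.
by apply: (@filterS _ (nbhs q) _ _ _ _ HW) => r Wr; exact: WV.
Qed.
End MartinExistence.

Section RandomWalk.
Context {R : realType} {Gamma : groupType}.
Context (mu : Gamma -> R).
Local Notation e := (1%g : Gamma).
Implicit Types (x y : Gamma) (n m : nat) (h : Gamma -> R) (l : R).

Definition supp : set Gamma := [set x | mu x != 0].

Definition finitely_supported_probability : Prop :=
  [/\ forall x, 0 <= mu x, finite_set supp &
      \sum_(x \in [set: Gamma]) mu x = 1].

Definition admissible : Prop :=
  smallest [set S : set Gamma | forall x y, S x -> S y -> S (x * y)%g] supp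
    = [set: Gamma].

Definition lazy : Prop := 0 < mu e.

Definition convolution_power n : Gamma -> R :=
  iter n (fun nu x => \sum_(y \in [set: Gamma]) mu y * nu (y^-1 * x)%g)
       (fun x => (x == e)%:R).

Definition transition n x y : R := convolution_power n (x^-1 * y)%g.

Definition walk_radius : R :=
  (limn_sup (fun n => transition n e e `^ n%:R^-1))^-1.

(* Junk value 0 if x is never reached; excluded by admissibility. *)
Definition word_length x : nat :=
  if pselect (exists n, 0 < transition n e x) is left ex
  then ex_minn ex else 0%N.

Definition green_function l x y : R :=
  limn (series (fun n => l ^+ n * transition n x y)).

Definition green_ratio l x y : R := green_function l x y / green_function l e y.

Definition zero_kernel x y : R :=
  if word_length y == (word_length x + word_length (x^-1 * y)%g)%N
  then transition (word_length y - word_length x) x y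
         / transition (word_length y) e y
  else 0.

(* Meant for 0 <= l <= walk_radius, so that the last case is l = walk_radius. *)
Definition lambda_kernel l x y : R :=
  if l == 0 then zero_kernel x y
  else if l < walk_radius then green_ratio l x y
  else lim (green_ratio t x y @[t --> walk_radius^'-]).

Definition mubar x y : R :=
  if (word_length x < word_length y)%N then mu (x^-1 * y)%g else 0.

(* l = 0 is the case of infinity-harmonic functions. *)
Definition lambda_harmonic l h : Prop :=
  if l == 0 then forall x, h x = \sum_(y \in [set: Gamma]) mubar x y * h y
  else forall x,
    \sum_(y \in [set: Gamma]) mu (x^-1 * y)%g * h y = l^-1 * h x.

Definition rescaling l x : R := if l == 0 then 1 else l ^+ word_length x.

Definition ST : Type := {p : Gamma * nat | 0 < transition p.2 e p.1}.

Lemma ST_base_subproof : 0 < transition 0 e e.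
Proof. by rewrite /transition /convolution_power /= invg1 mul1g eqxx ltr01. Qed.

Definition ST_base : ST :=
  exist (fun p : Gamma * nat => is_true (0 < transition p.2 e p.1)) (e, 0%N)
    ST_base_subproof.

Definition ST_trans (p q : ST) : R :=
  ((val p).2.+1 == (val q).2)%:R * mu ((val p).1^-1 * (val q).1)%g.

Definition ST_kernel (p q : ST) : R :=
  if ((val p).2 <= (val q).2)%N
  then transition ((val q).2 - (val p).2) (val p).1 (val q).1
         / transition (val q).2 e (val q).1
  else 0.

Definition ST_harmonic (f : ST -> R) : Prop :=
  forall p, \sum_(q \in [set: ST]) ST_trans p q * f q = f p.

Definition ST_minimal_boundary (C : compactification ST) : set C :=
  minimal_boundary ST_kernel ST_harmonic ST_base C.

Section LambdaBoundaries.
Context (C : R -> compactification Gamma).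

Definition minimal_lambda_boundary l : set (C l) :=
  minimal_boundary (lambda_kernel l) (lambda_harmonic l) e (C l).

Definition boundary_union : set {l : R & C l} :=
  [set p | 0 <= tag p <= walk_radius /\ minimal_lambda_boundary (tagged p)].

Definition rescaled_kernel (p : {l : R & C l}) x : R :=
  rescaling (tag p) x
  * extension (C (tag p)) (lambda_kernel (tag p) x) (tagged p).

Definition boundary_union_map (p : set_type boundary_union) :
    R * {ptws Gamma -> R} :=
  (tag (set_val p), rescaled_kernel (set_val p)).

Definition boundary_union_space : topologicalType :=
  initial_topology boundary_union_map.

End LambdaBoundaries.
End RandomWalk.

Arguments ST_kernel {R Gamma} mu p q.
Arguments ST_minimal_boundary {R Gamma} mu C.

Lemma boundary_union_cvgP (R : realType) (Gamma : groupType) (mu : Gamma -> R)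
    (C : R -> compactification Gamma)
    (u : nat -> boundary_union_space mu C) (p : boundary_union_space mu C) :
  u n @[n --> \oo] --> p <->
  tag (set_val (u n)) @[n --> \oo] --> tag (set_val p) /\
  forall x, rescaled_kernel mu (set_val (u n)) x @[n --> \oo]
            --> rescaled_kernel mu (set_val p) x.
Proof.
split=> [up|[up1 up2]].
  have H : boundary_union_map (u n) @[n --> \oo] --> boundary_union_map p.
    exact: (cvg_trans (cvg_app _ up) (@initial_continuous _ _ _ p)).
  split.
    exact: (cvg_trans (cvg_app fst H) (@cvg_fst _ _ _ _ _)).
  move=> x; have H2 : (boundary_union_map (u n)).2 @[n --> \oo]
    --> (boundary_union_map p).2.
    exact: (cvg_trans (cvg_app snd H) (@cvg_snd _ _ _ _ _)).
  exact: ((@cvg_ptwsP R Gamma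
    ((boundary_union_map (u n)).2 @[n --> \oo]) _ _).1 H2 x).
have H : boundary_union_map (u n) @[n --> \oo] --> boundary_union_map p.
  rewrite [boundary_union_map p]surjective_pairing.
  have FFo : Filter ((boundary_union_map (u n)).2 @[n --> \oo]).
    exact: fmap_filter.
  have K := (@cvg_ptwsP R Gamma ((boundary_union_map (u n)).2 @[n --> \oo])
    (boundary_union_map p).2 FFo).2 up2.
  have := @cvg_pair _ _ _ eventually (nbhs (boundary_union_map p).1)
    (nbhs (boundary_union_map p).2) _ _ _
    (fun n => (boundary_union_map (u n)).1)
    (fun n => (boundary_union_map (u n)).2) up1 K.
  by move=> Q; exact: (Q _ _ _).
move=> A; rewrite nbhsE => -[_ [[B Bo <-] Bp] BA].
have : nbhs (boundary_union_map p) B by exact: open_nbhs_nbhs.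
move=> /H HB; apply: (@filterS _ \oo _ _ _ _ HB) => n; exact: BA.
Qed.

(* Main.v *)
Require Import Defs.
From mathcomp Require Import all_boot all_order all_algebra.
From mathcomp Require Import all_classical all_reals all_analysis.
From mathcomp Require Import ring lra zify.
Import Order.TTheory GRing.Theory Num.Theory.
Import numFieldNormedType.Exports.

(** Both sides are copies of the set of minimal space-time harmonic functions
    with the topology of pointwise convergence.

    Let [f] be minimal on space-time. By laziness its time shift is harmonic and
    bounded by a multiple of [f], hence equal to [l f] for some [l >= 0]
    ([ST_minimal_is_product]). Therefore [f (x, n) = l ^ (n - |x|) k x] with
    [k x = f (x, |x|)], and for [l > 0] harmonicity of [f] says that
    [h x = k x / l ^ |x|] is harmonic at [l], while for [l = 0] it says that
    [h = k] is harmonic for the kernel that only lengthens words. Conversely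
    the product built from a minimal [h] is minimal on space-time: a harmonic
    function dominated by it scales by [l] under the time shift, again by
    laziness ([ST_shift_le_of_bounded], [minimal_rescaled_product]). A positive
    harmonic function at [l > 0] exists only if [l] is at most the radius
    ([harmonic_le_walk_radius]).

    A minimal harmonic function is the kernel of a unique boundary point.
    Uniqueness holds because the kernels separate the points of the Martin
    boundary and induce its topology ([martin_boundary_separated],
    [continuous_to_martin_boundary]). Existence is a Choquet-type argument with
    finitely additive measures ([minimal_kernel_limit]): it needs finitely
    supported measures escaping to infinity whose potentials approximate the
    function. On space-time and at [l = 0] these are the laws of the walk at
    time [n] weighted by the function. At a parameter where the Green function
    is finite they are the charges of [min h (k G)] restricted to large balls
    ([transient_kernel_limit]). If the Green function is infinite at the
    radius, nonnegative harmonic functions are unique up to scaling, and the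
    kernels are equal to this function for every pole
    ([recurrent_radius_kernel]).

    Finally [l = f (e, 1)], [k x = f (x, |x|)] and
    [f (x, n) = l ^ (n - |x|) k x] show that the bijection is continuous in both
    directions. *)

Set Implicit Arguments.
Unset Strict Implicit.
Unset Printing Implicit Defensive.

Local Open Scope classical_set_scope.
Local Open Scope ring_scope.

(** * Martin compactifications are determined by their kernels *)

Lemma continuous_ptws (R : realType) (T : choiceType) (Y : topologicalType)
    (f : Y -> {ptws T -> R}) :
  (forall t, continuous (fun y => f y t)) -> continuous f.
Proof. by move=> fc y; apply/(@cvg_ptwsP R T (f @ y)) => t; exact: fc. Qed.

Lemma initial_topology_continuous (S T U : topologicalType) (f : S -> T)
    (g : U -> initial_topology f) :
  continuous (f \o g) -> continuous g.
Proof.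
move=> fgc u A; rewrite nbhsE => -[_ [[W Wo <-] Wu] WA].
have : nbhs u ((f \o g) @^-1` W) by apply: fgc; exact: open_nbhs_nbhs.
by apply: (@filterS _ (nbhs u)) => v; exact: WA.
Qed.

(** Limits are taken along filters because these arise below as the mass-one
    sets of a finitely additive measure. *)
Definition kernel_limit {R : realType} (Omega : Type) (K : Omega -> Omega -> R)
    (h : Omega -> R) : Prop :=
  exists F : set_system Omega, [/\ ProperFilter F, forall y, F (~` [set y]) &
    forall x, K x y @[y --> F] --> h x].

Section MartinTopology.
Context {R : realType} {Omega : choiceType} (K : Omega -> Omega -> R).
Context (C : compactification Omega).

(** The Kronecker coordinates make the points of [Omega] isolated in the image
    of this map, so that the image is again a compactification of [Omega]. *)
Definition martin_coordinates (q : C) : {ptws (Omega + Omega)%type -> R} :=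
  fun i => match i with
           | inl x => extension C (K x) q
           | inr z => (q == cembed C z)%:R
           end.

Context (CK : is_martin_compactification K C).

Lemma extension_continuous x : continuous (extension C (K x)).
Proof. exact: (xgetPex (fun=> 0) (CK.1 x)).1. Qed.

Lemma extension_embed x y : extension C (K x) (cembed C y) = K x y.
Proof. exact: (xgetPex (fun=> 0) (CK.1 x)).2. Qed.

Lemma martin_coordinates_continuous : continuous martin_coordinates.
Proof.
apply: continuous_ptws => -[x|z]; first exact: extension_continuous.
move=> q; rewrite /martin_coordinates; have [->|qz] := eqVneq q (cembed C z).
  apply: cvg_near_cst; rewrite eqxx.
  have := open_nbhs_nbhs (conj (@cembed_open _ C z)
    (erefl _ : [set cembed C z] (cembed C z))).
  by apply: filterS => r ->; rewrite eqxx.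
apply: cvg_near_cst; rewrite (negbTE qz).
have cl : closed [set cembed C z].
  by apply: compact_closed; [exact: cspace_hausdorff|exact: compact_set1].
have : open_nbhs q (~` [set cembed C z]).
  by split; [exact: closed_openC|exact/eqP].
by move/open_nbhs_nbhs; apply: filterS => r /eqP rz; rewrite (negbTE rz).
Qed.

Let Im : topologicalType := set_type (range martin_coordinates).

Let to_Im (q : C) : Im :=
  exist _ (martin_coordinates q) (mem_set (imageT martin_coordinates q)).

Let to_Im_continuous : continuous to_Im.
Proof.
by apply: initial_topology_continuous; exact: martin_coordinates_continuous.
Qed.

Let Im_proj_continuous i : continuous (fun p : Im => set_val p i).
Proof.
move=> p; apply: (@continuous_comp Im {ptws (Omega + Omega)%type -> R} R
  set_val (@^~ i)); first exact: initial_continuous.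
exact: (@proj_continuous _ (fun=> R) i).
Qed.

Let Im_surj (p : Im) : exists q, p = to_Im q.
Proof.
have [q _ qp] := set_valP p; exists q; apply: val_inj; exact/esym.
Qed.

Let Im_compact : compact [set: Im].
Proof.
rewrite (_ : [set: Im] = to_Im @` setT).
  apply: continuous_compact; last exact: cspace_compact.
  by apply: continuous_subspaceT; exact: to_Im_continuous.
by rewrite eqEsubset; split => // p _; have [q ->] := Im_surj p; exists q.
Qed.

Let Im_hausdorff : hausdorff_space Im.
Proof.
move=> p q pq; apply: val_inj.
apply: (@hausdorff_product _ (fun=> R)) => [_|A B Ap Bq].
  exact: Rhausdorff.
have vc := @initial_continuous _ _ (set_val : Im -> _).
have [||r [Ar Br]] := pq (set_val @^-1` A) (set_val @^-1` B).
- exact: (vc p).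
- exact: (vc q).
by exists (set_val r).
Qed.

Let Im_embed_inj : injective (to_Im \o cembed C).
Proof.
move=> y z /(congr1 (fun p : Im => set_val p (inr y))) /=.
rewrite !set_valE /= eqxx; case: eqP => [zy _|_ /eqP].
  exact: (@cembed_inj _ C _ _ (esym zy)).
by rewrite oner_eq0.
Qed.

Let Im_embed_open y : open [set (to_Im \o cembed C) y].
Proof.
rewrite (_ : [set _] = (fun p : Im => set_val p (inr y)) @^-1` [set r | r != 0]).
  by move/continuousP : (@Im_proj_continuous (inr y)); apply; exact: open_neq.
rewrite eqEsubset; split => [_ ->|p] /=.
  by rewrite set_valE /= eqxx oner_neq0.
have [q ->] := Im_surj p; rewrite set_valE /=.
by case: (q =P cembed C y) => [->//|_]; rewrite eqxx.
Qed.

Let Im_embed_dense : dense (range (to_Im \o cembed C)).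
Proof.
move=> O [p Op] Oo; have [q qp] := Im_surj p.
have [||r [Or [y _ yr]]] := @cembed_dense _ C (to_Im @^-1` O).
- by exists q; rewrite /= -qp.
- by move/continuousP : to_Im_continuous; exact.
by exists (to_Im r); split => //; exists y => //=; rewrite yr.
Qed.

(** The image of [C] under the coordinates is itself a compactification to
    which all kernels extend, so minimality of [C] gives a map back. *)
Lemma martin_retraction : exists h : Im -> C,
  continuous h /\ forall q, h (to_Im q) = q.
Proof.
pose C' := Compactification Im_compact Im_hausdorff Im_embed_inj
  Im_embed_open Im_embed_dense.
have [x|h [hc hE]] := CK.2 C'.
  exists (fun p : Im => set_val p (inl x)); split => [|y] /=.
    exact: Im_proj_continuous.
  by rewrite set_valE /= extension_embed.
exists h; split => // q; apply: (@cspace_hausdorff _ C) => A B Aq Bq.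
have hq : nbhs q ((h \o to_Im) @^-1` A).
  by apply: (continuous_comp (@to_Im_continuous q) (hc _)).
have : nbhs q ((h \o to_Im) @^-1` A `&` B) by exact: filterI.
rewrite nbhsE => -[W [Wo Wq] WAB].
have [r [Wr [y _ yr]]] := @cembed_dense _ C W (ex_intro _ q Wq) Wo.
have [/= Ar Br] := WAB r Wr.
by exists r; split => //; move: Ar; rewrite -yr [h _]hE.
Qed.

Let boundary_indicator q z : martin_boundary C q -> (q == cembed C z) = false.
Proof. by move=> qC; apply/eqP => qz; apply: qC; exists z. Qed.

Lemma martin_boundary_separated (xi zeta : C) :
  martin_boundary C xi -> martin_boundary C zeta ->
  (forall x, extension C (K x) xi = extension C (K x) zeta) -> xi = zeta.
Proof.
move=> bx bz e; have [h [_ hE]] := martin_retraction.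
rewrite -[xi]hE -[zeta]hE; congr h; apply: val_inj => /=.
by apply/funext => -[x|z] /=; rewrite ?e// !boundary_indicator.
Qed.

Lemma continuous_to_martin_boundary (Y : topologicalType) (g : Y -> C) :
  (forall y, martin_boundary C (g y)) ->
  (forall x, continuous (fun y => extension C (K x) (g y))) -> continuous g.
Proof.
move=> gC gc; have [h [hc hE]] := martin_retraction.
rewrite (_ : g = h \o (to_Im \o g)); last by apply/funext => y /=; rewrite hE.
have tc : continuous (to_Im \o g).
  apply: initial_topology_continuous; apply: continuous_ptws => -[x|z].
    exact: gc.
  rewrite (_ : (fun y => _) = cst 0); first exact: cst_continuous.
  apply/funext => y; rewrite -[LHS]/((g y == cembed C z)%:R).
  by rewrite boundary_indicator.
by move=> y; apply: continuous_comp; [exact: tc|exact: hc].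
Qed.

(** By compactness the filter has a cluster point; isolated points are excluded
    because the filter eventually avoids them. *)
Lemma martin_boundary_of_kernel_limit (h : Omega -> R) : kernel_limit K h ->
  exists2 xi, martin_boundary C xi & forall x, extension C (K x) xi = h x.
Proof.
move=> [F [PF Fpt Fh]].
have PF' : ProperFilter (cembed C @ F) by exact: fmap_proper_filter.
have [|xi [_ xiF]] := @cspace_compact _ C (cembed C @ F) PF'.
  by apply: (@filterE _ F) => y.
exists xi => [[y _ yxi]|x].
  have [|p [/= py]] := xiF (cembed C @` ~` [set y]) [set cembed C y] _
      (open_nbhs_nbhs (conj (@cembed_open _ C y) (esym yxi))).
    by apply: (@filterS _ F) (Fpt y) => z zy; exists z.
  by move=> pE; case: py => z zy; rewrite pE => /(@cembed_inj _ C).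
apply: (@Rhausdorff R) => A B Ax Bx.
have HA := @extension_continuous x xi A Ax.
have [|p [[y By yp] Ap]] := xiF (cembed C @` (K x @^-1` B)) _ _ HA.
  by apply: (@filterS _ F) (Fh x B Bx) => y; exists y.
by exists (K x y); split => //; move: Ap; rewrite /= -yp extension_embed.
Qed.

End MartinTopology.

(** * Minimal functions are limits of Martin kernels *)

Lemma cvg_sum (R : realType) (T I : Type) (F : set_system T) (s : seq I)
    (f : I -> T -> R) (l : I -> R) : Filter F ->
  (forall i, f i t @[t --> F] --> l i) ->
  \sum_(i <- s) f i t @[t --> F] --> \sum_(i <- s) l i.
Proof.
by move=> FF fl; apply: cvg_big => [|i _]; [exact: add_continuous|exact: fl].
Qed.

Lemma ultrafilter_fmap (T S : Type) (f : T -> S) (U : set_system T) :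
  UltraFilter U -> UltraFilter (f @ U).
Proof.
move=> UU; split; first exact: fmap_proper_filter.
move=> G GG UG; rewrite eqEsubset; split => // A GA.
have [//|UA] := in_ultra_setVsetC (f @^-1` A) UU.
have GA' : G (~` A) by exact: UG.
by have /filter_ex [? []] : G (A `&` ~` A) by exact: filterI.
Qed.

Lemma ultrafilter_bounded_cvg (R : realType) (T : Type) (U : set_system T)
    (u : T -> R) (M : R) :
  UltraFilter U -> (\forall k \near U, 0 <= u k <= M) ->
  exists l : R, u k @[k --> U] --> l.
Proof.
move=> UU uM.
have UU' : UltraFilter (u @ U) by exact: ultrafilter_fmap.
have := @segment_compact R 0 M; rewrite compact_ultra => /(_ (u @ U) UU').
move=> [|l [_ ul]]; last by exists l.
by apply: (@filterS _ U) uM => k; rewrite /= in_itv.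
Qed.

Lemma ultrafilter_cvg (R : realType) (T : Type) (F : set_system T)
    (f : T -> R) (l : R) : ProperFilter F ->
  (forall U, UltraFilter U -> F `<=` U -> f t @[t --> U] --> l) ->
  f t @[t --> F] --> l.
Proof.
move=> PF Ul A Al; apply: contrapT => nFA.
pose G : set_system T := [set B | F (B `|` f @^-1` A)].
have FG : F `<=` G by move=> B; apply: filterS => t Bt; left.
have PG : ProperFilter G.
  split; first by rewrite /G /= set0U.
  split; first by apply: FG; exact: filterT.
  - move=> B1 B2 G1 G2.
    have : F ((B1 `|` f @^-1` A) `&` (B2 `|` f @^-1` A)) by exact: filterI.
    apply: filterS => t.
    by move=> [[b1|?]] [b2|?]; [left|right..].
  - move=> B1 B2 B12; apply: (@filterS _ F) => t.
    by move=> [/B12 ?|?]; [left|right].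
have [U [UU GU]] := ultraFilterLemma PG.
have := Ul U UU (subset_trans FG GU) A Al.
have : U (~` (f @^-1` A)).
  apply: GU; rewrite /G /= setUC setUv; exact: filterT.
move=> U1 U2; apply: (@filter_not_empty _ U _).
have : U (~` (f @^-1` A) `&` f @^-1` A) by exact: filterI.
by apply: filterS => t [].
Qed.

Section MinimalKernelLimit.
Context {R : realType} {Omega : choiceType} (K : Omega -> Omega -> R).
Context (harmonic : (Omega -> R) -> Prop) (o : Omega) (h : Omega -> R).
Context (nbs : Omega -> seq Omega) (a : Omega -> Omega -> R).
Context (r : nat -> seq Omega) (w : nat -> Omega -> R).
Context (harmonicE : forall f,
  harmonic f <-> forall x, f x = \sum_(z <- nbs x) a x z * f z).
Context (K_ge0 : forall x y, 0 <= K x y) (Ko : forall y, K o y = 1).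
Context (w_ge0 : forall k y, 0 <= w k y).
Context (w_vanish : forall y, \forall k \near \oo, w k y = 0).
Context (K_harmonic : forall x, \forall k \near \oo, forall y, w k y != 0 ->
  K x y = \sum_(z <- nbs x) a x z * K z y).
Context (w_cvg : forall x,
  \sum_(y <- r k) K x y * w k y @[k --> \oo] --> h x).

Let S (A : set Omega) x k := \sum_(y <- r k) (y \in A)%:R * (K x y * w k y).

Let S_ge0 A x k : 0 <= S A x k.
Proof. by apply: sumr_ge0 => y _; rewrite !mulr_ge0. Qed.

Let S_le (A B : set Omega) x k : A `<=` B -> S A x k <= S B x k.
Proof.
move=> AB; apply: ler_sum => y _; rewrite ler_wpM2r ?mulr_ge0// ler_nat.
case: (boolP (y \in A)) => // /set_mem /AB /mem_set -> //.
Qed.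

Let S_setT x k : S setT x k = \sum_(y <- r k) K x y * w k y.
Proof. by apply: eq_bigr => y _; rewrite in_setT mul1r. Qed.

Let S_setU A B x k : S (A `|` B) x k <= S A x k + S B x k.
Proof.
rewrite -big_split; apply: ler_sum => y _ /=.
rewrite -mulrDl ler_wpM2r ?mulr_ge0// -natrD ler_nat in_setU.
by case: (y \in A); case: (y \in B).
Qed.

Let S_harmonic A x : \forall k \near \oo,
  S A x k = \sum_(z <- nbs x) a x z * S A z k.
Proof.
near=> k; rewrite /S.
under [RHS]eq_bigr do rewrite mulr_sumr.
rewrite exchange_big /=; apply: eq_bigr => y _.
have [->|wy] := eqVneq (w k y) 0.
  by rewrite !mulr0 big1// => z _; rewrite !mulr0.
rewrite (_ : K x y = \sum_(z <- nbs x) a x z * K z y); last first.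
  by move: y wy; near: k; exact: K_harmonic.
by rewrite mulr_suml mulr_sumr; apply: eq_bigr => z _; ring.
Unshelve. all: by end_near.
Qed.

(** The [w k], summed over [r k], are finitely supported measures whose mass
    leaves every point and whose potentials converge to [h]. Restricting them
    to a set [A] of poles and passing to the limit along an ultrafilter gives
    a harmonic function below [h], which by minimality is [m A * h]. The sets
    whose complement has mass zero form a filter. The mass [m] vanishes on a
    set where [K x] exceeds [h x + e], as otherwise the restricted limit would
    be too large at [x], and likewise where [K x] is below [h x - e]. *)
Lemma minimal_kernel_limit :
  minimal_harmonic harmonic o h -> kernel_limit K h.
Proof.
move=> [hh h0 ho hmin].
have [U [UU oU]] := @ultraFilterLemma _ (\oo : set_system nat) _.
have near_U (P : nat -> Prop) : (\forall k \near \oo, P k) -> U P by exact: oU.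
have S_cvg A x : exists l : R, S A x k @[k --> U] --> l.
  apply: (@ultrafilter_bounded_cvg _ _ _ _ (h x + 1)) => //.
  apply: near_U; near=> k; rewrite S_ge0 /=.
  apply: (le_trans (@S_le A setT x k (@subsetT _ _))); rewrite S_setT.
  by near: k; apply: cvgr_le (@w_cvg x) _ _; rewrite ltrDl.
pose H A x := sval (cid (S_cvg A x)).
have HP A x : S A x k @[k --> U] --> H A x by exact: svalP (cid (S_cvg A x)).
have H_ge0 A x : 0 <= H A x.
  by apply: cvgr_to_ge (HP A x) _; exact: nearW.
have H_le A B x : A `<=` B -> H A x <= H B x.
  move=> AB; apply: (ler_cvg_to (HP A x) (HP B x)).
  by apply: nearW => k; exact: S_le.
have H_setT x : H setT x = h x.
  have wU : \sum_(y <- r k) K x y * w k y @[k --> U] --> h x.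
    by move=> B /(@w_cvg x); exact: oU.
  apply: (@cvg_unique _ (@Rhausdorff R) _ _ _ _ (HP setT x)).
  rewrite /= (_ : S setT x = (fun k => \sum_(y <- r k) K x y * w k y)) //.
  by apply/funext => k; exact: S_setT.
have H_harmonic A : harmonic (H A).
  apply/harmonicE => x.
  apply: (@cvg_unique _ (@Rhausdorff R) _ _ _ _ (HP A x)).
  apply: (@cvg_trans _ (\sum_(z <- nbs x) a x z * S A z k @[k --> U])).
    apply: near_eq_cvg; apply: near_U; near=> k.
    by apply/esym; near: k; exact: S_harmonic.
  by apply: cvg_sum => z; exact: cvgMl_tmp.
have HE A x : H A x = H A o * h x.
  have [|c cP] := hmin (H A) (H_harmonic A) (H_ge0 A).
    by exists 1 => // y; rewrite mul1r -H_setT; exact: H_le.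
  by rewrite !cP ho mulr1.
pose m A := H A o.
have m_ge0 A : 0 <= m A by exact: H_ge0.
have m_le0 A : m A <= 0 -> m A = 0 by move=> ?; apply/le_anti/andP.
have mU A B : m (A `|` B) <= m A + m B.
  apply: (ler_cvg_to (HP _ _) (cvgD (HP A o) (HP B o))).
  by apply: nearW => k; exact: S_setU.
pose F : set_system Omega := [set A | m (~` A) = 0].
exists F.
have Fsub A B : A `<=` B -> F A -> F B.
  move=> AB FA; apply: m_le0; rewrite -FA; apply: H_le; exact: subsetC.
have PF : ProperFilter F.
  split; first by rewrite /F /= setC0 /m H_setT ho => /eqP; rewrite oner_eq0.
  split => //.
  - rewrite /F /= setCT.
    apply: (@cvg_unique _ (@Rhausdorff R) _ _ _ _ (HP _ _)).
    rewrite (_ : S _ _ = cst 0); first exact: cvg_cst.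
    by apply/funext => k; rewrite /S big1// => y _; rewrite in_set0 mul0r.
  - move=> A B FA FB; apply: m_le0; rewrite setCI.
    by rewrite (le_trans (mU _ _))// FA FB addr0.
split => // [y|x].
  rewrite /F /= setCK.
  apply: (@cvg_unique _ (@Rhausdorff R) _ _ _ _ (HP _ _)).
  apply: cvg_near_cst; apply: near_U; near=> k.
  rewrite /S big1// => z _; have [->|zy] := eqVneq z y.
    rewrite (_ : w k y = 0) ?mulr0//; near: k; exact: w_vanish.
  rewrite (_ : _ \in _ = false) ?mul0r//; apply/negbTE/negP => /set_mem /= zy'.
  by rewrite zy' eqxx in zy.
apply/cvgrPdist_le => e e0.
have bound (A : set Omega) : 0 < m A -> forall c,
    (forall y, A y -> c <= K x y) -> c <= h x.
  move=> mA c cK; rewrite -(ler_pM2r mA) [X in _ <= X]mulrC -HE.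
  have L : c * S A o k @[k --> U] --> c * m A by exact: cvgMl_tmp.
  apply: (ler_cvg_to L (HP A x)).
  apply: nearW => k; rewrite /S mulr_sumr; apply: ler_sum => y _.
  rewrite Ko mul1r (mulrCA c); case: (boolP (y \in A)) => [/set_mem yA|_].
    by rewrite !mul1r ler_wpM2r// cK.
  by rewrite !mul0r.
have bound' (A : set Omega) : 0 < m A -> forall c,
    (forall y, A y -> K x y <= c) -> h x <= c.
  move=> mA c cK; rewrite -(ler_pM2r mA) [X in X <= _]mulrC -HE.
  have L : c * S A o k @[k --> U] --> c * m A by exact: cvgMl_tmp.
  apply: (ler_cvg_to (HP A x) L).
  apply: nearW => k; rewrite /S mulr_sumr; apply: ler_sum => y _.
  rewrite Ko mul1r (mulrCA c); case: (boolP (y \in A)) => [/set_mem yA|_].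
    by rewrite !mul1r ler_wpM2r// cK.
  by rewrite !mul0r.
have F1 : F [set y | K x y < h x + e].
  rewrite /F /=; apply: m_le0; rewrite leNgt; apply/negP => mA.
  suff : h x + e <= h x by rewrite gerDl leNgt e0.
  by apply: (bound _ mA) => y /= /negP; rewrite -leNgt.
have F2 : F [set y | h x - e < K x y].
  rewrite /F /=; apply: m_le0; rewrite leNgt; apply/negP => mA.
  suff : h x <= h x - e by rewrite lerDl oppr_ge0 leNgt e0.
  by apply: (bound' _ mA) => y /= /negP; rewrite -leNgt.
have : F ([set y | K x y < h x + e] `&` [set y | h x - e < K x y]).
  exact: filterI.
apply: filterS => y [/= y1 y2].
by rewrite ler_norml; apply/andP; split; lra.
Unshelve. all: by end_near.
Qed.

End MinimalKernelLimit.

(** * Transition probabilities and word length *)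

Section Walk.
Context {R : realType} {Gamma : groupType} (mu : Gamma -> R).
Local Notation e := (1%g : Gamma).
Context (mu_prob : finitely_supported_probability mu).
Context (mu_admissible : admissible mu) (mu_lazy : lazy mu).

Definition steps : seq Gamma := finmap.enum_fset (fset_set (supp mu)).

Definition walk_step (h : Gamma -> R) (x : Gamma) : R :=
  \sum_(s <- steps) mu s * h (x * s)%g.

Local Notation p := (transition mu).
Local Notation "`| x |" := (word_length mu x) : nat_scope.

Lemma mu_ge0 x : 0 <= mu x.
Proof. by case: mu_prob. Qed.
Hint Resolve mu_ge0 : core.

Lemma mem_steps s : (s \in steps) = (mu s != 0).
Proof.
have [_ Sf _] := mu_prob.
by rewrite in_fset_set//; apply/idP/idP => [/set_mem|/mem_set].
Qed.

Lemma steps_uniq : uniq steps.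
Proof. exact: finmap.fset_uniq. Qed.

Lemma sum_steps (F : Gamma -> R) :
  \sum_(y \in [set: Gamma]) mu y * F y = \sum_(s <- steps) mu s * F s.
Proof.
rewrite (@fsbigTE _ _ _ _ (fset_set (supp mu)))// => y.
rewrite -[_ \in _]/(y \in steps) mem_steps negbK => /eqP ->.
by rewrite mul0r.
Qed.

Lemma sum_steps_shift x (F : Gamma -> R) :
  \sum_(y \in [set: Gamma]) mu (x^-1 * y)%g * F y =
  \sum_(s <- steps) mu s * F (x * s)%g.
Proof.
rewrite -(sum_steps (fun s => F (x * s)%g)).
rewrite (reindex_fsbigT (fun s => (x * s)%g)).
  by apply: eq_fsbigr => s _; rewrite mulKg.
by exists (fun s => (x^-1 * s)%g) => s; rewrite ?mulKg ?mulVKg.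
Qed.

Lemma sum_mu1 : \sum_(s <- steps) mu s = 1.
Proof.
have [_ _ <-] := mu_prob; rewrite (eq_fsbigr (fun y => mu y * 1)).
  by rewrite (sum_steps (fun=> 1)); apply: eq_bigr => s _; rewrite mulr1.
by move=> y _; rewrite mulr1.
Qed.

Lemma transition0 x y : p 0 x y = (x == y)%:R.
Proof.
rewrite /transition /convolution_power /= -(inj_eq (mulgI x)) mulVKg mulg1.
by rewrite eq_sym.
Qed.

Lemma transitionS n x y : p n.+1 x y = walk_step (fun z => p n z y) x.
Proof.
rewrite /transition /convolution_power /= sum_steps.
by apply: eq_bigr => s _; rewrite invgM mulgA.
Qed.

Lemma transition1g n x y : p n x y = p n e (x^-1 * y)%g.
Proof. by rewrite /transition invg1 mul1g. Qed.

Lemma transition_shift n z x y : p n (z * x)%g (z * y)%g = p n x y.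
Proof. by rewrite /transition invgM -mulgA mulKg. Qed.

Lemma transition_ge0 n x y : 0 <= p n x y.
Proof.
elim: n x => [|n IH] x; first by rewrite transition0.
by rewrite transitionS sumr_ge0// => s _; rewrite mulr_ge0.
Qed.
Hint Resolve transition_ge0 : core.

Lemma transition_le1 n x y : p n x y <= 1.
Proof.
elim: n x => [|n IH] x; first by rewrite transition0 lern1 leq_b1.
rewrite transitionS -sum_mu1; apply: ler_sum => s _.
by rewrite ler_piMr.
Qed.

Lemma transition_mul n m x y z : p n x y * p m y z <= p (n + m) x z.
Proof.
elim: n x => [|n IH] x.
  rewrite transition0; case: eqP => [->|_]; rewrite ?mul1r// mul0r//.
rewrite addSn !transitionS mulr_suml; apply: ler_sum => s _.
by rewrite -mulrA ler_wpM2l.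
Qed.

Lemma transition_step x s : p 1 x (x * s)%g = mu s.
Proof.
rewrite transitionS /walk_step.
under eq_bigr do rewrite transition0 (inj_eq (mulgI x)).
have [s0|sS] := eqVneq (mu s) 0.
  rewrite s0 big1_seq// => t; rewrite mem_steps => /= t0.
  by case: eqP => [ts|_]; rewrite ?mulr0//; rewrite ts s0 eqxx in t0.
rewrite -mem_steps in sS; rewrite (bigD1_seq s)//= ?steps_uniq//.
rewrite eqxx mulr1 big1 ?addr0// => t /negbTE ->; exact: mulr0.
Qed.

Lemma transition_lazy n x y : p n x y * mu e <= p n.+1 x y.
Proof.
have := @transition_step y e; rewrite mulg1 => <-.
by rewrite -[n.+1]addn1; exact: transition_mul.
Qed.

Lemma transition_lazy_gt0 n m x y : (n <= m)%N -> 0 < p n x y -> 0 < p m x y.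
Proof.
move=> /subnK <-; elim: (m - n)%N => // k IH /IH xy; rewrite addSn.
by apply: (lt_le_trans _ (transition_lazy _ _ _)); rewrite mulr_gt0.
Qed.

Lemma reachable x : exists n, 0 < p n e x.
Proof.
have : [set: Gamma] x by [].
rewrite -mu_admissible => /(_ [set z | exists n, 0 < p n e z]).
apply; split => [y z [n ny] [m mz]|y /eqP yS].
  exists (n + m)%N; apply: (lt_le_trans _ (transition_mul n m e y _)).
  by rewrite mulr_gt0// transition1g mulKg.
exists 1%N; have := transition_step e y; rewrite mul1g => ->.
by rewrite lt_neqAle mu_ge0 eq_sym; apply/andP; split => //; apply/eqP.
Qed.

Lemma word_length_transition n x : (0 < p n e x) = (`|x| <= n)%N.
Proof.
rewrite /word_length; case: pselect => [ex|/(_ (reachable x))//].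
case: ex_minnP => m mx mmin; apply/idP/idP; first exact: mmin.
by move=> mn; exact: transition_lazy_gt0 mx.
Qed.

Lemma transition_gt0 n x y : (0 < p n x y) = (`|(x^-1 * y)%g| <= n)%N.
Proof. by rewrite transition1g word_length_transition. Qed.

Lemma transition_eq0 n x y : (n < `|(x^-1 * y)%g|)%N -> p n x y = 0.
Proof.
rewrite ltnNge -transition_gt0 -leNgt => xy.
by apply/le_anti; rewrite xy transition_ge0.
Qed.

Lemma word_length1 : `|e|%N = 0%N.
Proof.
by apply/eqP; rewrite -leqn0 -word_length_transition transition0 eqxx.
Qed.

Lemma word_lengthM x y : (`|(x * y)%g| <= `|x| + `|y|)%N.
Proof.
rewrite -word_length_transition.
apply: (lt_le_trans _ (transition_mul _ _ e x _)); rewrite mulr_gt0//.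
  by rewrite word_length_transition.
by rewrite transition_gt0 mulKg.
Qed.

Lemma word_length_le x y : (`|y| <= `|x| + `|(x^-1 * y)%g|)%N.
Proof. by have := word_lengthM x (x^-1 * y); rewrite mulVKg. Qed.

Lemma word_length_step x s : mu s != 0 -> (`|(x * s)%g| <= `|x|.+1)%N.
Proof.
move=> s0; apply: leq_trans (word_lengthM _ _) _.
rewrite -addn1 leq_add2l -word_length_transition.
by have := transition_step e s; rewrite mul1g => ->; rewrite lt_neqAle eq_sym s0 /=.
Qed.

Lemma ball_finite n : finite_set [set x | (`|x| <= n)%N].
Proof.
suff [L LP] : exists L : seq Gamma, forall x, 0 < p n e x -> x \in L.
  apply: (@sub_finite_set _ _ [set` L]) => // x /=.
  by rewrite -word_length_transition; exact: LP.
elim: n => [|n [L LP]].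
  exists [:: e] => x; rewrite transition0 inE eq_sym.
  by case: eqP => //; rewrite ltxx.
exists [seq (s * x)%g | s <- steps, x <- L] => x; rewrite transitionS => x0.
have [s sS sx] : exists2 s, s \in steps & 0 < p n (e * s)%g x.
  apply: contrapT => nex; move: x0; rewrite /walk_step big1_seq ?ltxx// => s /= sS.
  apply/eqP; rewrite mulf_eq0; apply/orP; right.
  rewrite -[_ == 0]negbK; apply/negP => sx; apply: nex; exists s => //.
  by rewrite lt_neqAle eq_sym sx /=.
have /LP xL : 0 < p n e (s^-1 * x)%g by move: sx; rewrite mul1g transition1g.
by apply/allpairsP; exists (s, (s^-1 * x)%g); rewrite /= mulVKg.
Qed.

Definition ball n : seq Gamma :=
  finmap.enum_fset (fset_set [set x | (`|x| <= n)%N]).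

Lemma ball_uniq n : uniq (ball n).
Proof. exact: finmap.fset_uniq. Qed.

Lemma mem_ball n x : (x \in ball n) = (`|x| <= n)%N.
Proof.
rewrite in_fset_set; last exact: ball_finite.
by apply/idP/idP => [/set_mem|/mem_set].
Qed.

Lemma le_walk_step g h x : (forall y, g y <= h y) ->
  walk_step g x <= walk_step h x.
Proof. by move=> gh; apply: ler_sum => s _; rewrite ler_wpM2l. Qed.

Lemma walk_step_ge0 h x : (forall y, 0 <= h y) -> 0 <= walk_step h x.
Proof. by move=> h0; apply: sumr_ge0 => s _; rewrite mulr_ge0. Qed.

Lemma iter_walk_step_ge0 n h x :
  (forall y, 0 <= h y) -> 0 <= iter n walk_step h x.
Proof. by move=> h0; elim: n x => // n IH x; exact: walk_step_ge0. Qed.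

Lemma walk_stepZ c h x : walk_step (fun y => c * h y) x = c * walk_step h x.
Proof. by rewrite mulr_sumr; apply: eq_bigr => s _; rewrite mulrCA. Qed.

Lemma walk_stepB g h x :
  walk_step (fun y => g y - h y) x = walk_step g x - walk_step h x.
Proof. by rewrite -sumrB; apply: eq_bigr => s _; rewrite mulrBr. Qed.

Lemma eq_walk_step g h x : (forall y, g y = h y) -> walk_step g x = walk_step h x.
Proof. by move=> gh; apply: eq_bigr => s _; rewrite gh. Qed.

Lemma sum_transition_le n B psi x : uniq B -> (forall y, 0 <= psi y) ->
  \sum_(y <- B) p n x y * psi y <= iter n walk_step psi x.
Proof.
move=> uB psi0; elim: n x => [|n IH] x /=.
  under eq_bigr do rewrite transition0.
  have [xB|xB] := boolP (x \in B).
    rewrite (bigD1_seq x)//= eqxx mul1r big1 ?addr0// => y.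
    by rewrite eq_sym => /negbTE ->; rewrite mul0r.
  rewrite big1_seq// => y /= yB; case: eqP => [xy|_]; last by rewrite mul0r.
  by rewrite xy yB in xB.
rewrite (eq_bigr (fun y => \sum_(s <- steps) mu s * (p n (x * s)%g y * psi y))).
  rewrite exchange_big; apply: ler_sum => s _ /=.
  by rewrite -mulr_sumr ler_wpM2l.
by move=> y _; rewrite transitionS mulr_suml; apply: eq_bigr => s _; rewrite mulrA.
Qed.

Lemma transition_le_iter n psi x y : (forall z, 0 <= psi z) ->
  p n x y * psi y <= iter n walk_step psi x.
Proof.
by move=> psi0; have := @sum_transition_le n [:: y] psi x isT psi0; rewrite big_seq1.
Qed.

Lemma sum_transition n m psi x : (`|x| + n <= m)%N ->
  \sum_(y <- ball m) p n x y * psi y = iter n walk_step psi x.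
Proof.
elim: n x => [|n IH] x xm /=.
  under eq_bigr do rewrite transition0.
  rewrite (bigD1_seq x)/= ?ball_uniq//; last by rewrite mem_ball -[X in (X <= _)%N]addn0.
  rewrite eqxx mul1r big1 ?addr0// => y.
  by rewrite eq_sym => /negbTE ->; rewrite mul0r.
rewrite (eq_bigr (fun y => \sum_(s <- steps) mu s * (p n (x * s)%g y * psi y))).
  rewrite exchange_big; apply: eq_big_seq => s /=.
  rewrite mem_steps => /(word_length_step x) xs.
  by rewrite -mulr_sumr IH//; lia.
by move=> y _; rewrite transitionS mulr_suml; apply: eq_bigr => s _; rewrite mulrA.
Qed.

(** * Space-time harmonic functions of product form *)

Lemma mu_e_gt0 : 0 < mu e. Proof. exact: mu_lazy. Qed.

(** Equation satisfied by [k x = l ^ |x| h x] for [h] harmonic at [l]. One step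
    lengthens a word by at most one, so no negative power of [l] occurs, and
    at [l = 0] the factor [0 ^ 0] selects the steps that lengthen the word. *)
Definition rescaled_harmonic (l : R) (k : Gamma -> R) : Prop := forall x,
  k x = \sum_(s <- steps)
    mu s * (l ^+ (`|x|.+1 - `|(x * s)%g|)%N * k (x * s)%g).

Lemma rescaling_gt0 l x : 0 <= l -> 0 < rescaling mu l x.
Proof.
move=> l0; rewrite /rescaling; case: (eqVneq l 0) => [_|ln]; first exact: ltr01.
by rewrite exprn_gt0// lt_neqAle eq_sym ln.
Qed.

Lemma rescaling1 l : rescaling mu l e = 1.
Proof. by rewrite /rescaling; case: ifP => // _; rewrite word_length1. Qed.

Lemma lambda_harmonic_gt0 l h : 0 < l ->
  lambda_harmonic mu l h <-> forall x, h x = l * walk_step h x.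
Proof.
move=> l0; rewrite /lambda_harmonic gt_eqF//.
split => hh x; have := hh x; rewrite sum_steps_shift -/(walk_step h x) => E.
  by rewrite E mulrA divff ?gt_eqF// mul1r.
by rewrite [in RHS]hh mulrA mulVf ?gt_eqF// mul1r.
Qed.

Lemma lambda_harmonicE l h : 0 <= l -> lambda_harmonic mu l h <->
  rescaled_harmonic l (fun x => rescaling mu l x * h x).
Proof.
move=> l0; rewrite /rescaled_harmonic; have [l00|lN0] := eqVneq l 0.
  rewrite /lambda_harmonic /rescaling l00 eqxx.
  suff E x : \sum_(y \in [set: Gamma]) mubar mu x y * h y = \sum_(s <- steps)
      mu s * (0 ^+ (`|x|.+1 - `|(x * s)%g|)%N * (1 * h (x * s)%g)).
    by split => hh x; [rewrite mul1r hh|rewrite E -hh mul1r].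
  transitivity (\sum_(y \in [set: Gamma]) mu (x^-1 * y)%g *
      (if (`|x| < `|y|)%N then h y else 0)).
    apply: eq_fsbigr => y _; rewrite /mubar.
    by case: ifP => _; rewrite ?mul0r ?mulr0.
  rewrite sum_steps_shift; apply: eq_bigr => s _.
  by rewrite expr0n subn_eq0 mul1r; case: ifP => _; rewrite ?mul1r ?mul0r.
have lp : 0 < l by rewrite lt_neqAle eq_sym lN0.
rewrite lambda_harmonic_gt0// /rescaling (negbTE lN0).
have E x : \sum_(s <- steps) mu s * (l ^+ (`|x|.+1 - `|(x * s)%g|)%N *
    (l ^+ `|(x * s)%g| * h (x * s)%g)) = l ^+ `|x| * (l * walk_step h x).
  rewrite mulrA -exprSr mulr_sumr; apply: eq_big_seq => s.
  rewrite mem_steps => /(word_length_step x) xs.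
  by rewrite [in RHS]mulrCA mulrA mulrA -exprD subnK// mulrA.
split => hh x; first by rewrite E -hh.
by have := hh x; rewrite E => /(mulfI (lt0r_neq0 (exprn_gt0 _ lp))).
Qed.

Lemma ST_le (q : ST mu) : (`|(val q).1| <= (val q).2)%N.
Proof. by rewrite -word_length_transition; exact: valP q. Qed.

Definition ST_point x n (xn : (`|x| <= n)%N) : ST mu.
Proof. by exists (x, n); rewrite word_length_transition. Defined.

Definition st_extend (f : ST mu -> R) x n : R :=
  oapp f 0 (insub (x, n) : option (ST mu)).

Lemma st_extendT f x n (xn : (`|x| <= n)%N) :
  st_extend f x n = f (ST_point xn).
Proof.
rewrite /st_extend insubT/= ?word_length_transition// => xn'.
by congr f; apply: val_inj.
Qed.

Lemma st_extend_val f (q : ST mu) : st_extend f (val q).1 (val q).2 = f q.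
Proof. by rewrite (st_extendT f (ST_le q)); congr f; apply: val_inj; case: q => -[]. Qed.

Definition ST_next (q : ST mu) : seq (ST mu) :=
  pmap insub [seq ((val q).1 * s, (val q).2.+1)%g | s <- steps].

Lemma sum_ST_next q f : \sum_(r <- ST_next q) ST_trans q r * f r =
  \sum_(s <- steps) mu s * st_extend f ((val q).1 * s)%g (val q).2.+1.
Proof.
rewrite big_pmap big_map; apply: eq_big_seq => s.
rewrite mem_steps => /(word_length_step (val q).1) xs.
have xs' : (`|((val q).1 * s)%g| <= (val q).2.+1)%N.
  by apply: leq_trans xs _; rewrite ltnS ST_le.
rewrite (st_extendT _ xs') insubT/= ?word_length_transition// => xs''.
rewrite /ST_trans /= eqxx mul1r mulKg; congr (_ * f _); exact: val_inj.
Qed.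

Lemma sum_ST_trans q f : \sum_(r \in [set: ST mu]) ST_trans q r * f r =
  \sum_(r <- ST_next q) ST_trans q r * f r.
Proof.
rewrite [RHS]fsbig_seq; last first.
  rewrite pmap_sub_uniq// map_inj_uniq ?steps_uniq// => s t [] /mulgI//.
apply/esym/fsbig_widen => // r [_ /= rN].
rewrite /ST_trans; case: eqP => [E|_]; last by rewrite !mul0r.
have [->|m0] := eqVneq (mu ((val q).1^-1 * (val r).1)%g) 0.
  by rewrite mulr0 mul0r.
exfalso; apply: rN; rewrite mem_pmap_sub; apply/mapP.
exists ((val q).1^-1 * (val r).1)%g; first by rewrite mem_steps.
by rewrite mulVKg E; case: (val r).
Qed.

Lemma ST_harmonic_next f : ST_harmonic f <->
  forall q, f q = \sum_(r <- ST_next q) ST_trans q r * f r.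
Proof. by split=> fh q; [rewrite -sum_ST_trans fh|rewrite sum_ST_trans -fh]. Qed.

Lemma ST_harmonicE f : ST_harmonic f <-> forall x n, (`|x| <= n)%N ->
  st_extend f x n = \sum_(s <- steps) mu s * st_extend f (x * s)%g n.+1.
Proof.
rewrite ST_harmonic_next; split => [fh x n xn|fh q].
  by rewrite (st_extendT _ xn) fh sum_ST_next.
by rewrite sum_ST_next -fh ?ST_le// st_extend_val.
Qed.

(** Iterated mean value property: every point that the walk can reach from [x]
    in [m] steps lies in the ball of radius [m + n]. *)
Lemma ST_harmonic_iter f m x n : ST_harmonic f -> (`|x| <= n)%N ->
  st_extend f x n =
    \sum_(y <- ball (m + n)) p m x y * st_extend f y (m + n).
Proof.
move=> /ST_harmonicE fh; elim: m x n => [|m IH] x n xn.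
  under eq_bigr do rewrite transition0.
  rewrite (bigD1_seq x)/= ?ball_uniq ?mem_ball// eqxx mul1r big1 ?addr0// => y.
  by rewrite eq_sym => /negbTE ->; rewrite mul0r.
rewrite fh// addSnnS; under [RHS]eq_bigr do rewrite transitionS mulr_suml.
rewrite exchange_big; apply: eq_big_seq => s /=.
rewrite mem_steps => /(word_length_step x) xs.
rewrite IH ?(leq_trans xs)// mulr_sumr.
by apply: eq_bigr => y _; rewrite mulrA.
Qed.

(** This is [l ^ n h x] with [h = k / l ^ |x|], written so that it still makes
    sense when [l = 0]; there it is [k x] at the first possible visit to [x]
    and zero afterwards. *)
Definition st_product (l : R) (k : Gamma -> R) (q : ST mu) : R :=
  l ^+ ((val q).2 - `|(val q).1|) * k (val q).1.

Definition ST_root x : ST mu := ST_point (leqnn `|x|).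

Lemma st_product_root l k x : st_product l k (ST_root x) = k x.
Proof. by rewrite /st_product /= subnn mul1r. Qed.

Lemma st_product_harmonic l k :
  ST_harmonic (st_product l k) <-> rescaled_harmonic l k.
Proof.
have E x n : (`|x| <= n)%N -> \sum_(s <- steps) mu s *
    st_extend (st_product l k) (x * s)%g n.+1 = l ^+ (n - `|x|) *
    \sum_(s <- steps) mu s * (l ^+ (`|x|.+1 - `|(x * s)%g|)%N * k (x * s)%g).
  move=> xn; rewrite mulr_sumr; apply: eq_big_seq => s.
  rewrite mem_steps => /(word_length_step x) xs.
  have xsn : (`|(x * s)%g| <= n.+1)%N by apply: leq_trans xs _.
  rewrite (st_extendT _ xsn) /st_product/= [RHS]mulrCA; congr (_ * _).
  by rewrite mulrA -exprD; congr (_ ^+ _ * _); lia.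
rewrite ST_harmonicE; split => kh x; last first.
  by move=> n xn; rewrite E// (st_extendT _ xn) -kh.
by have := kh x _ (leqnn _); rewrite E// subnn mul1r st_extendT st_product_root.
Qed.

Lemma st_product_ge0 l k q : 0 <= l -> (forall x, 0 <= k x) ->
  0 <= st_product l k q.
Proof. by move=> l0 k0; rewrite mulr_ge0// exprn_ge0. Qed.

Definition ST_shift (q : ST mu) : ST mu := ST_point (leqW (ST_le q)).

Lemma st_product_shift l k q :
  st_product l k (ST_shift q) = l * st_product l k q.
Proof. by rewrite /st_product /= subSn ?ST_le// exprS mulrA. Qed.

Lemma st_productP l f : (forall q, f (ST_shift q) = l * f q) ->
  f = st_product l (f \o ST_root).
Proof.
move=> fl; apply/funext => q.
have E n x (xn : (`|x| <= n)%N) :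
    f (ST_point xn) = l ^+ (n - `|x|) * f (ST_root x).
  elim: n xn => [|n IH] xn.
    have x0 : `|x|%N = 0%N by apply/eqP; rewrite -leqn0.
    by rewrite x0 subnn mul1r; congr f; apply: val_inj; rewrite /= x0.
  have [xE|xn'] : `|x|%N = n.+1 \/ (`|x| <= n)%N.
    by move: (xn); rewrite leq_eqVlt => /orP[/eqP|]; [left|right].
    by rewrite xE subnn mul1r; congr f; apply: val_inj; rewrite /= xE.
  rewrite subSn// exprS -mulrA -(IH xn') -fl; congr f; exact: val_inj.
rewrite /st_product /= -(E _ _ (ST_le q)); congr f.
by apply: val_inj; case: q => -[].
Qed.

Lemma ST_shift_harmonic f : ST_harmonic f -> ST_harmonic (f \o ST_shift).
Proof.
move=> /ST_harmonicE fh; apply/ST_harmonicE => x n xn.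
have E y m : (`|y| <= m)%N -> st_extend (f \o ST_shift) y m = st_extend f y m.+1.
  move=> ym; rewrite (st_extendT _ ym) (st_extendT _ (leqW ym)) /=.
  by congr f; exact: val_inj.
rewrite E// fh ?leqW//; apply: eq_big_seq => s.
rewrite mem_steps => /(word_length_step x) xs; rewrite E//.
exact: leq_trans xs _.
Qed.

(** Laziness: staying put is one of the steps in the mean value property. *)
Lemma ST_shift_le f q : ST_harmonic f -> (forall r, 0 <= f r) ->
  mu e * f (ST_shift q) <= f q.
Proof.
move=> /ST_harmonicE fh f0; rewrite -[in leRHS]st_extend_val fh ?ST_le//.
rewrite (bigD1_seq e)/= ?steps_uniq ?mem_steps ?gt_eqF ?mu_e_gt0//.
rewrite mulg1 (st_extendT _ (leqW (ST_le q))) lerDl sumr_ge0// => s _.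
by rewrite mulr_ge0// /st_extend; case: insub => //=.
Qed.

Lemma ST_harmonicB (f g : ST mu -> R) (a b : R) : ST_harmonic f -> ST_harmonic g ->
  ST_harmonic (fun q => a * f q - b * g q).
Proof.
move=> /ST_harmonic_next fh /ST_harmonic_next gh.
apply/ST_harmonic_next => q; rewrite {1}fh {1}gh !mulr_sumr -sumrB.
by apply: eq_bigr => r _; ring.
Qed.

(** * Minimality in space-time and minimality on the group *)

(** If [W q = g (ST_shift q) - l g q] were positive somewhere, take a point where
    [W / f] is within a small margin of its supremum [s > 0]. The function
    [s f - W] is nonnegative and harmonic, and laziness bounds it along the
    shifts of that point, so [W / f >= s / 2] for many consecutive times.
    Summing these increments makes [g / f] exceed any bound. *)
Lemma ST_shift_le_of_bounded (l C : R) (f g : ST mu -> R) : 0 < l ->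
  ST_harmonic f -> (forall q, f (ST_shift q) = l * f q) ->
  (forall q, 0 < f q) -> ST_harmonic g -> (forall q, `|g q| <= C * f q) ->
  forall q, g (ST_shift q) <= l * g q.
Proof.
move=> l0 fh fs f0 gh gC q0; rewrite leNgt; apply/negP => W0.
pose W q := 1 * g (ST_shift q) - l * g q.
have Wh : ST_harmonic W by apply: ST_harmonicB => //; exact: ST_shift_harmonic.
have C0 : 0 <= C.
  by have := le_trans (normr_ge0 _) (gC q0); rewrite pmulr_lge0.
pose E := range (fun q => W q / f q).
have WC q : W q <= (2 * C * l) * f q.
  rewrite /W mul1r (le_trans (ler_norm _))// (le_trans (ler_normB _ _))//.
  rewrite normrM (gtr0_norm l0).
  have := gC (ST_shift q); rewrite fs => g1.
  have := ler_wpM2l (ltW l0) (gC q) => g2.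
  by apply: le_trans (lerD g1 g2) _; rewrite le_eqVlt; apply/orP; left; apply/eqP; ring.
have Esup : has_sup E.
  split; first by exists (W q0 / f q0), q0.
  by exists (2 * C * l) => _ [q _ <-]; rewrite ler_pdivrMr.
pose s := sup E.
have Ws q : W q <= s * f q.
  by rewrite -ler_pdivrMr//; apply: (sup_upper_bound Esup); exists q.
have s0 : 0 < s.
  rewrite -(pmulr_lgt0 _ (f0 q0)); apply: lt_le_trans (Ws q0).
  by rewrite /W mul1r subr_gt0.
pose a := mu e; have a0 : 0 < a := mu_e_gt0.
pose b := a * l; have b0 : 0 < b by rewrite mulr_gt0.
have b1 : b <= 1.
  rewrite -(ler_pM2r (f0 q0)) mul1r /b -mulrA -fs.
  by apply: ST_shift_le => // r; exact: ltW.
have [N HN] : exists N : nat, 4 * C * l / s < N%:R.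
  exists (Num.bound (4 * C * l / s)); apply: archi_boundP.
  by rewrite !mulr_ge0 ?invr_ge0 ?(ltW s0) ?(ltW l0).
pose eps := s / 2 * b ^+ N.
have eps0 : 0 < eps by rewrite mulr_gt0 ?exprn_gt0 ?divr_gt0.
have [_ [q _ <-] Hq] := sup_adherent eps0 Esup.
rewrite ltr_pdivlMr// -/s in Hq.
pose V r := s * f r - 1 * W r.
have Vh : ST_harmonic V by exact: ST_harmonicB.
have V0 r : 0 <= V r by rewrite /V mul1r subr_ge0.
pose qj j := iter j ST_shift q.
have fqj j : f (qj j) = l ^+ j * f q.
  by elim: j => [|j IH] /=; rewrite ?mul1r// fs IH exprS mulrA.
have Vqj j : a ^+ j * V (qj j) <= V q.
  elim: j => [|j IH]; first by rewrite mul1r.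
  apply: le_trans IH; rewrite exprSr -mulrA ler_wpM2l ?exprn_ge0 ?(ltW a0)//.
  exact: (ST_shift_le (qj j) Vh V0).
have Wqj j : (j <= N)%N -> s / 2 * (l ^+ j * f q) <= W (qj j).
  move=> jN; have : a ^+ j * V (qj j) <= a ^+ j * (s / 2 * (l ^+ j * f q)).
    apply: le_trans (Vqj j) _.
    have : V q <= eps * f q by rewrite /V; lra.
    move=> /le_trans; apply.
    have -> : a ^+ j * (s / 2 * (l ^+ j * f q)) = s / 2 * b ^+ j * f q.
      by rewrite /b exprMn; ring.
    rewrite ler_wpM2r ?(ltW (f0 _))// ler_wpM2l ?divr_ge0 ?(ltW s0)//.
    by rewrite ler_wiXn2l// ltW.
  rewrite ler_pM2l ?exprn_gt0// /V fqj; lra.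
have grow j : (j <= N)%N ->
    l ^+ j * (l * g q + j%:R * (s / 2) * f q) <= l * g (qj j).
  elim: j => [|j IH] jN; first by rewrite mul0r mul0r addr0 mul1r.
  have W1 := Wqj j (ltnW jN); have IH1 := IH (ltnW jN).
  have -> : g (qj j.+1) = W (qj j) + l * g (qj j) by rewrite /W /=; ring.
  have W2 := lerD (ler_wpM2l (ltW l0) W1) (ler_wpM2l (ltW l0) IH1).
  rewrite [leRHS]mulrDr; apply: (le_trans _ W2).
  by rewrite exprS -natr1 le_eqVlt; apply/orP; left; apply/eqP; ring.
have := grow N (leqnn N); apply/negP; rewrite -ltNge.
have gN : l * g (qj N) <= l * (C * (l ^+ N * f q)).
  by rewrite ler_pM2l// -fqj (le_trans (ler_norm _)).
apply: le_lt_trans gN _.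
rewrite (_ : l * _ = l ^+ N * (l * C * f q)); last by ring.
rewrite ltr_pM2l ?exprn_gt0//.
have gq : - (C * f q) <= g q by have := gC q; rewrite ler_norml => /andP[].
have lgq : l * - (C * f q) <= l * g q by rewrite ler_pM2l.
have : 2 * C * l * f q < N%:R * (s / 2) * f q.
  rewrite ltr_pM2r//; move: HN; rewrite ltr_pdivrMr// => HN; lra.
lra.
Qed.

(** From any point the walk reaches the identity with positive probability. *)
Lemma rescaled_harmonic_gt0 l k : 0 < l -> rescaled_harmonic l k ->
  (forall x, 0 <= k x) -> k e = 1 -> forall x, 0 < k x.
Proof.
move=> l0 kh k0 ke x.
pose h y := k y / l ^+ `|y|.
have lN y : l ^+ `|y| != 0 by rewrite gt_eqF// exprn_gt0.
have kE y : k y = rescaling mu l y * h y.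
  by rewrite /rescaling gt_eqF// /h mulrC divfK.
have h0 y : 0 <= h y by rewrite divr_ge0 ?exprn_ge0 ?(ltW l0).
have hh : forall y, h y = l * walk_step h y.
  apply/lambda_harmonic_gt0 => //; apply/lambda_harmonicE; first exact: ltW.
  by rewrite (_ : (fun y => _) = k)//; apply/funext => y; rewrite -kE.
have hn n y : h y = l ^+ n * iter n walk_step h y.
  elim: n y => [|n IH] y; first by rewrite mul1r.
  by rewrite hh /= (eq_walk_step _ IH) walk_stepZ exprS mulrA.
rewrite kE mulr_gt0 ?rescaling_gt0 ?ltW//.
rewrite (hn `|(x^-1 * e)%g|%N) mulr_gt0 ?exprn_gt0//.
apply: (lt_le_trans _ (transition_le_iter _ _ e h0)).
by rewrite /h ke word_length1 divr1 mulr1 transition_gt0.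
Qed.

Lemma minimal_lambda_rescaled l h : 0 <= l ->
  minimal_harmonic (lambda_harmonic mu l) e h <->
  minimal_harmonic (rescaled_harmonic l) e (fun x => rescaling mu l x * h x).
Proof.
move=> l0; have r0 x := rescaling_gt0 x l0.
split=> -[hh h0 he hmin]; split.
- exact/lambda_harmonicE.
- by move=> x; rewrite mulr_ge0// ltW.
- by rewrite rescaling1 mul1r.
- move=> g gh g0 [c c0 gc].
  have gE x : g x = rescaling mu l x * (g x / rescaling mu l x).
    by rewrite mulrCA divff ?mulr1// gt_eqF.
  have [||| d dP] := hmin (fun x => g x / rescaling mu l x).
  + apply/lambda_harmonicE => //; rewrite (_ : (fun x => _) = g)//.
    by apply/funext => x; rewrite -gE.
  + by move=> x; rewrite divr_ge0// (ltW (r0 x)).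
  + by exists c => // x; rewrite ler_pdivrMr// -mulrA [h x * _]mulrC.
  by exists d => x; rewrite gE dP mulrCA.
- exact/lambda_harmonicE.
- by move=> x; rewrite -(pmulr_rge0 _ (r0 x)).
- by rewrite -he rescaling1 mul1r.
- move=> g gh g0 [c c0 gc].
  have [||| d dP] := hmin (fun x => rescaling mu l x * g x).
  + exact/lambda_harmonicE.
  + by move=> x; rewrite mulr_ge0// ltW.
  + by exists c => // x; rewrite mulrCA ler_pM2l.
  exists d => x; apply: (mulfI (lt0r_neq0 (r0 x))).
  by rewrite dP mulrCA.
Qed.

Lemma ST_base_root : ST_base mu = ST_root e.
Proof. by apply: val_inj; rewrite /= word_length1. Qed.

(** The substantial direction is from [k] to the product: a harmonic [g]
    dominated by the product must itself scale by [l] under the shift. For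
    [l = 0] domination forces it to vanish after the first visit; for [l > 0]
    the boundedness argument applies to [g] and to [- g]. *)
Lemma minimal_rescaled_product l k : 0 <= l ->
  minimal_harmonic (rescaled_harmonic l) e k <->
  minimal_harmonic (@ST_harmonic _ _ mu) (ST_base mu) (st_product l k).
Proof.
move=> l0; split=> -[kh k0 ke kmin]; split.
- exact/st_product_harmonic.
- by move=> q; exact: st_product_ge0.
- by rewrite ST_base_root st_product_root.
- move=> g gh g0 [c c0 gc].
  suff gs q : g (ST_shift q) = l * g q.
    have gE := st_productP gs.
    have [||| d dP] := kmin (g \o ST_root).
    + by apply/st_product_harmonic; rewrite -gE.
    + by move=> x; exact: g0.
    + by exists c => // x; rewrite -(st_product_root l k); exact: gc.
    by exists d => q; rewrite {1}gE /st_product dP; ring.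
  have [l00|lN] := eqVneq l 0.
    rewrite l00 mul0r; apply: le_anti; rewrite g0 andbT.
    by apply: le_trans (gc _) _; rewrite st_product_shift l00 mul0r mulr0.
  have lp : 0 < l by rewrite lt_neqAle eq_sym lN.
  have kp := rescaled_harmonic_gt0 lp kh k0 ke.
  have fp r : 0 < st_product l k r by rewrite mulr_gt0// exprn_gt0.
  have fh : ST_harmonic (st_product l k) by exact/st_product_harmonic.
  have fs := st_product_shift l k.
  apply: le_anti; apply/andP; split.
    apply: (@ST_shift_le_of_bounded l c _ g lp fh fs fp gh) => r.
    by rewrite ger0_norm.
  rewrite -lerN2 -mulrN.
  have ngh : ST_harmonic (fun q => 0 * g q - 1 * g q) by exact: ST_harmonicB.
  have := @ST_shift_le_of_bounded l c _ _ lp fh fs fp ngh.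
  move=> /(_ _ q); rewrite !mul0r !sub0r !mul1r; apply => r.
  by rewrite mul0r sub0r mul1r normrN ger0_norm.
- exact/st_product_harmonic.
- by move=> x; rewrite -(st_product_root l).
- by rewrite -(st_product_root l) -ST_base_root.
- move=> g gh g0 [c c0 gc].
  have [||| d dP] := kmin (st_product l g).
  + exact/st_product_harmonic.
  + by move=> q; exact: st_product_ge0.
  + exists c => // q; rewrite /st_product mulrCA.
    by rewrite ler_wpM2l// exprn_ge0.
  by exists d => x; rewrite -(st_product_root l g) dP st_product_root.
Qed.

(** The shift of a harmonic function is harmonic and, by laziness, at most
    a constant times the function; minimality makes it a multiple. *)
Lemma ST_minimal_is_product f :
  minimal_harmonic (@ST_harmonic _ _ mu) (ST_base mu) f ->
  exists2 l, 0 <= l & f = st_product l (f \o ST_root).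
Proof.
move=> [fh f0 fe fmin].
have [||| l lP] := fmin (f \o ST_shift).
- exact: ST_shift_harmonic.
- by move=> q; exact: f0.
- exists (mu e)^-1; first by rewrite invr_gt0 mu_e_gt0.
  move=> q; rewrite ler_pdivlMl ?mu_e_gt0//; exact: ST_shift_le.
exists l; last by apply: st_productP => q; rewrite -lP.
by have := lP (ST_base mu); rewrite fe mulr1 => <-; exact: f0.
Qed.

(** * Kernel limits: space-time and the case [l = 0] *)

Definition ST_level n : seq (ST mu) := pmap insub [seq (y, n) | y <- ball n].

Lemma ST_kernelE (q r : ST mu) : ((val q).2 <= (val r).2)%N ->
  ST_kernel mu q r = p ((val r).2 - (val q).2) (val q).1 (val r).1
                     / p (val r).2 e (val r).1.
Proof. by rewrite /ST_kernel => ->. Qed.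

Lemma ST_kernel_ge0 (q r : ST mu) : 0 <= ST_kernel mu q r.
Proof. by rewrite /ST_kernel; case: ifP => // _; rewrite divr_ge0. Qed.

Lemma ST_kernel_base (r : ST mu) : ST_kernel mu (ST_base mu) r = 1.
Proof. by rewrite ST_kernelE//= subn0 divff// gt_eqF//; exact: valP r. Qed.

Lemma ST_kernel_harmonic (q r : ST mu) : ((val q).2 < (val r).2)%N ->
  ST_kernel mu q r =
  \sum_(q' <- ST_next q) ST_trans q q' * ST_kernel mu q' r.
Proof.
move=> qr; rewrite (sum_ST_next q (fun q' => ST_kernel mu q' r)).
rewrite ST_kernelE ?(ltnW qr)// -(subnSK qr) transitionS mulr_suml.
apply: eq_big_seq => s; rewrite mem_steps => /(word_length_step (val q).1) xs.
have xs' : (`|((val q).1 * s)%g| <= (val q).2.+1)%N.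
  by apply: leq_trans xs _; rewrite ltnS ST_le.
by rewrite (st_extendT _ xs') ST_kernelE//= mulrA.
Qed.

(** The approximating measures are the laws of the walk at time [n], weighted
    by [f]; they reproduce [f] exactly by the Markov property. *)
Lemma ST_kernel_limit f :
  minimal_harmonic (@ST_harmonic _ _ mu) (ST_base mu) f ->
  kernel_limit (ST_kernel mu) f.
Proof.
move=> fmin; have [fh f0 _ _] := fmin.
pose w n (q : ST mu) := if (val q).2 == n then p n e (val q).1 * f q else 0.
apply: (@minimal_kernel_limit _ _ (ST_kernel mu) _ _ f ST_next
  (fun q r => ST_trans q r) ST_level w _ _ _ _ _ _ _ fmin).
- exact: ST_harmonic_next.
- exact: ST_kernel_ge0.
- exact: ST_kernel_base.
- by move=> n q; rewrite /w; case: ifP => // _; rewrite mulr_ge0.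
- move=> q; exists (val q).2.+1 => // n /= qn.
  by rewrite /w ltn_eqF.
- move=> q; exists (val q).2.+1 => // n /= qn r.
  rewrite /w; case: (eqVneq (val r).2 n) => [rn _|_]; last by rewrite eqxx.
  by apply: ST_kernel_harmonic; rewrite rn.
- move=> q; apply: cvg_near_cst; exists (val q).2 => // n /= qn.
  rewrite big_pmap big_map -[RHS]st_extend_val.
  rewrite (ST_harmonic_iter (n - (val q).2) fh (ST_le q)) subnK//.
  apply: eq_big_seq => y; rewrite mem_ball => yn.
  have yn' : 0 < p n e y by rewrite word_length_transition.
  rewrite (st_extendT _ yn) insubT/=.
  rewrite /w ST_kernelE//= eqxx mulrA divfK ?gt_eqF//; congr (_ * f _).
  exact: val_inj.
Qed.

(** If [|x| <= |y| < |x| + |x^-1 y|], then [|y| - |x|] steps do not lead from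
    [x] to [y], so the quotient agrees with the value zero of the kernel. *)
Lemma zero_kernelE x y : (`|x| <= `|y|)%N ->
  zero_kernel mu x y = p (`|y| - `|x|) x y / p `|y| e y.
Proof.
move=> xy; rewrite /zero_kernel; case: eqP => // /eqP yN.
rewrite transition_eq0 ?mul0r//.
have := word_length_le x y; rewrite leq_eqVlt (negbTE yN) /=; lia.
Qed.

Lemma zero_kernel_ge0 x y : 0 <= zero_kernel mu x y.
Proof. by rewrite /zero_kernel; case: ifP => // _; rewrite divr_ge0. Qed.

Definition group_next x : seq Gamma := [seq (x * s)%g | s <- steps].

Lemma sum_mubar x (F : Gamma -> R) :
  \sum_(y \in [set: Gamma]) mubar mu x y * F y =
  \sum_(y <- group_next x) mubar mu x y * F y.
Proof.
transitivity (\sum_(y \in [set: Gamma]) mu (x^-1 * y)%g *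
    ((`|x| < `|y|)%N%:R * F y)).
  by apply: eq_fsbigr => y _; rewrite /mubar; case: ifP; rewrite ?mul1r ?mul0r ?mulr0.
rewrite sum_steps_shift big_map; apply: eq_bigr => s _.
by rewrite /mubar mulKg; case: ifP; rewrite ?mul1r ?mul0r ?mulr0.
Qed.

Lemma zero_kernel_harmonic x y : (`|x| < `|y|)%N ->
  zero_kernel mu x y = \sum_(z <- group_next x) mubar mu x z * zero_kernel mu z y.
Proof.
move=> xy; rewrite zero_kernelE ?(ltnW xy)// -(subnSK xy) transitionS mulr_suml.
rewrite big_map; apply: eq_big_seq => s; rewrite mem_steps => sN.
rewrite /mubar mulKg; have xs := word_length_step x sN.
case: ifPn => [xs'|]; last rewrite -leqNgt => xs'.
  have -> : `|x|.+1 = `|(x * s)%g|%N by apply/eqP; rewrite eqn_leq xs xs'.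
  by rewrite zero_kernelE ?mulrA// (leq_trans xs).
rewrite [p _ _ _]transition_eq0 ?mulr0 ?mul0r//.
have := word_length_le (x * s)%g y; lia.
Qed.

(** The space-time measures for the product with [l = 0] are carried by the
    spheres, where the space-time kernel and the kernel at zero agree. *)
Lemma zero_kernel_limit h :
  minimal_harmonic (lambda_harmonic mu 0) e h -> kernel_limit (zero_kernel mu) h.
Proof.
move=> hmin; have [hh h0 _ _] := hmin.
pose w n (y : Gamma) := if `|y|%N == n then p n e y * h y else 0.
have fh : ST_harmonic (st_product 0 h).
  apply/st_product_harmonic; rewrite (_ : h = fun x => rescaling mu 0 x * h x).
    exact/lambda_harmonicE.
  by apply/funext => x; rewrite /rescaling eqxx mul1r.
apply: (@minimal_kernel_limit _ _ (zero_kernel mu) _ _ h group_next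
  (mubar mu) ball w _ _ _ _ _ _ _ hmin).
- move=> g; rewrite /lambda_harmonic eqxx.
  by split => gh x; rewrite gh sum_mubar// -sum_mubar -gh.
- exact: zero_kernel_ge0.
- move=> y; rewrite zero_kernelE ?word_length1// subn0 divff// gt_eqF//.
  by rewrite word_length_transition.
- by move=> n q; rewrite /w; case: ifP => // _; rewrite mulr_ge0.
- by move=> y; exists `|y|.+1 => // n /= yn; rewrite /w ltn_eqF.
- move=> x; exists `|x|.+1 => // n /= xn y.
  rewrite /w; case: (eqVneq `|y|%N n) => [yn _|_]; last by rewrite eqxx.
  by apply: zero_kernel_harmonic; rewrite yn.
- move=> x; apply: cvg_near_cst; exists `|x|%N => // n /= xn.
  rewrite -(st_product_root 0 h) -st_extend_val/=.
  rewrite (ST_harmonic_iter (n - `|x|) fh (leqnn _)) subnK//.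
  apply: eq_big_seq => y; rewrite mem_ball => yn.
  rewrite (st_extendT _ yn) /st_product /= /w expr0n subn_eq0.
  have [yn'|yn'] := eqVneq `|y|%N n; last first.
    by rewrite leqNgt ltn_neqAle yn' yn/= !mul0r !mulr0.
  rewrite zero_kernelE yn' ?leqnn ?mul1r// mulrA divfK// gt_eqF//.
  by rewrite word_length_transition.
Qed.

(** * Green functions and superharmonic functions *)

Definition green_term (l : R) x y : R^nat := fun n => l ^+ n * p n x y.

Definition green_sum l x y n : R := series (green_term l x y) n.

Definition transient (l : R) : Prop := cvgn (series (green_term l e e)).

Lemma nonneg_series_cvg (u : R^nat) (M : R) : (forall n, 0 <= u n) ->
  (forall n, series u n <= M) -> cvgn (series u).
Proof.
move=> u0 uM; apply: nondecreasing_is_cvgn.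
  by apply: nondecreasing_series => n _ _; exact: u0.
by exists M => _ [n _ <-].
Qed.

Lemma nonneg_series_le_lim (u : R^nat) n : (forall n, 0 <= u n) ->
  cvgn (series u) -> series u n <= limn (series u).
Proof.
move=> u0 cu; apply: nondecreasing_cvgn_le => //.
by apply: nondecreasing_series => k _ _; exact: u0.
Qed.

Section Green.
Context (l : R) (l0 : 0 < l).

Let l_ge0 : 0 <= l := ltW l0.

Lemma green_term_ge0 x y n : 0 <= green_term l x y n.
Proof. by rewrite mulr_ge0 ?exprn_ge0. Qed.
Hint Resolve green_term_ge0 : core.

Lemma green_sum0 x y : green_sum l x y 0 = 0.
Proof. by rewrite /green_sum /series/= big_geq. Qed.

Lemma green_sumSr x y n : green_sum l x y n.+1 =
  green_sum l x y n + l ^+ n * p n x y.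
Proof. by rewrite /green_sum seriesSr. Qed.

Lemma green_sumS x y n : green_sum l x y n.+1 =
  (x == y)%:R + l * walk_step (fun z => green_sum l z y n) x.
Proof.
rewrite /green_sum /series/= big_nat_recl// /green_term mul1r transition0.
congr (_ + _); rewrite mulr_sumr.
under eq_bigr do rewrite transitionS mulr_sumr.
rewrite exchange_big /=; apply: eq_bigr => s _.
by rewrite mulr_sumr mulr_sumr; apply: eq_bigr => i _; rewrite exprS; ring.
Qed.

Lemma green_sum_prolong x y z : exists2 c, 0 < c & exists k,
  forall n, green_sum l x y n <= c * green_sum l x z (n + k).
Proof.
pose k := `|(y^-1 * z)%g|%N; have pk : 0 < p k y z by rewrite transition_gt0.
have ck : 0 < l ^+ k * p k y z by rewrite mulr_gt0// exprn_gt0.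
exists (l ^+ k * p k y z)^-1; first by rewrite invr_gt0.
exists k => m; rewrite ler_pdivlMl//.
elim: m => [|m IH].
  by rewrite green_sum0 mulr0; apply: sumr_ge0 => i _; exact: green_term_ge0.
rewrite green_sumSr addSn green_sumSr mulrDr lerD//.
have -> : l ^+ k * p k y z * (l ^+ m * p m x y) =
    l ^+ (m + k) * (p m x y * p k y z) by rewrite exprD; ring.
by rewrite ler_wpM2l ?exprn_ge0// transition_mul.
Qed.

Lemma green_sum_diag x n : green_sum l x x n = green_sum l e e n.
Proof.
by apply: eq_bigr => i _; rewrite /green_term -(transition_shift i x e) mulg1.
Qed.

Section Transient.
Context (tr : transient l).

Lemma green_cvg x y : cvgn (series (green_term l x y)).
Proof.
have [c c0 [k ck]] := green_sum_prolong x y x.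
apply: (@nonneg_series_cvg _ (c * limn (series (green_term l e e)))) => // n.
apply: le_trans (ck n) _; rewrite ler_pM2l// green_sum_diag.
exact: nonneg_series_le_lim.
Qed.

Lemma green_function_cvg x y :
  green_sum l x y n @[n --> \oo] --> green_function mu l x y.
Proof. exact: green_cvg. Qed.

Lemma green_sum_le x y n : green_sum l x y n <= green_function mu l x y.
Proof. by apply: nonneg_series_le_lim => //; exact: green_cvg. Qed.

Lemma green_function_gt0 x y : 0 < green_function mu l x y.
Proof.
apply: lt_le_trans (green_sum_le x y (`|(x^-1 * y)%g|).+1).
rewrite green_sumSr ltr_wpDl ?sumr_ge0// mulr_gt0 ?exprn_gt0//.
by rewrite transition_gt0.
Qed.

Lemma green_functionE x y : green_function mu l x y =
  (x == y)%:R + l * walk_step (fun z => green_function mu l z y) x.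
Proof.
have H : green_sum l x y n.+1 @[n --> \oo] --> green_function mu l x y.
  by have := @green_function_cvg x y; rewrite -[X in X -> _]cvg_shiftS.
apply: (@cvg_unique _ (@Rhausdorff R) _ _ _ _ H).
rewrite /= (_ : (fun n => _) = (fun n => (x == y)%:R +
    l * walk_step (fun z => green_sum l z y n) x)); last first.
  by apply/funext => n; rewrite green_sumS.
apply: cvgD; first exact: cvg_cst.
apply: cvgMl_tmp; apply: cvg_sum => s; apply: cvgMl_tmp.
exact: green_function_cvg.
Qed.

End Transient.

Lemma iter_walk_step_defect u n x :
  iter n walk_step (fun y => u y - l * walk_step u y) x =
  iter n walk_step u x - l * iter n.+1 walk_step u x.
Proof.
elim: n x => // n IH x /=.
by rewrite (eq_walk_step _ IH) walk_stepB walk_stepZ.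
Qed.

Lemma sum_iter_walk_step_defect u n x :
  \sum_(0 <= i < n) l ^+ i *
    iter i walk_step (fun y => u y - l * walk_step u y) x =
  u x - l ^+ n * iter n walk_step u x.
Proof.
elim: n => [|n IH]; first by rewrite big_geq//= mul1r subrr.
by rewrite big_nat_recr//= IH iter_walk_step_defect exprS /=; ring.
Qed.

Lemma green_sum_iter psi x z n : (forall y, 0 <= psi y) ->
  green_sum l x z n * psi z <= \sum_(0 <= i < n) l ^+ i * iter i walk_step psi x.
Proof.
move=> psi0; rewrite mulr_suml; apply: ler_sum => i _.
by rewrite -mulrA ler_wpM2l ?exprn_ge0// transition_le_iter.
Qed.

Lemma superharmonic_sum_le u n x : (forall y, 0 <= u y) ->
  \sum_(0 <= i < n) l ^+ i *
    iter i walk_step (fun y => u y - l * walk_step u y) x <= u x.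
Proof.
move=> u0; rewrite sum_iter_walk_step_defect gerBl.
by rewrite mulr_ge0 ?exprn_ge0// iter_walk_step_ge0.
Qed.

Lemma superharmonic_iter_le u n x : (forall y, l * walk_step u y <= u y) ->
  l ^+ n * iter n walk_step u x <= u x.
Proof.
move=> us; rewrite -subr_ge0 -sum_iter_walk_step_defect sumr_ge0// => i _.
by rewrite mulr_ge0 ?exprn_ge0// iter_walk_step_ge0// => y; rewrite subr_ge0.
Qed.

(** A defect at [z] would be charged at each return to [z], and the expected
    number of weighted returns is infinite. *)
Lemma recurrent_superharmonic u : ~ transient l -> (forall y, 0 <= u y) ->
  (forall y, l * walk_step u y <= u y) -> forall y, u y = l * walk_step u y.
Proof.
move=> rec u0 us z; apply/eqP; rewrite -subr_eq0 eq_le subr_ge0 us andbT.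
rewrite leNgt; apply/negP => dz; apply: rec.
pose psi y := u y - l * walk_step u y.
apply: (@nonneg_series_cvg _ (u z / psi z)) => // n.
rewrite ler_pdivlMr// -[series _ _]/(green_sum l e e n) -(green_sum_diag z).
apply: (le_trans (green_sum_iter _ _ _ _)) => [y|]; first by rewrite subr_ge0.
exact: superharmonic_sum_le.
Qed.

Lemma harmonic_eq0 u : (forall y, 0 <= u y) ->
  (forall y, u y = l * walk_step u y) -> u e = 0 -> forall x, u x = 0.
Proof.
move=> u0 uh ue x.
have un n y : u y = l ^+ n * iter n walk_step u y.
  elim: n y => [|n IH] y; first by rewrite mul1r.
  by rewrite uh /= (eq_walk_step _ IH) walk_stepZ exprS mulrA.
have px : 0 < p `|x| e x by rewrite word_length_transition.
apply/le_anti; rewrite u0 andbT -(pmulr_rle0 _ px).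
rewrite -(pmulr_rle0 _ (exprn_gt0 `|x| l0)) -ue (un `|x|%N e).
by rewrite ler_wpM2l ?exprn_ge0// transition_le_iter.
Qed.

(** The minimum of two harmonic functions is superharmonic, hence harmonic;
    so the positive part of the difference is a nonnegative harmonic function
    vanishing at the identity. *)
Lemma recurrent_unique u v : ~ transient l ->
  (forall y, 0 <= u y) -> (forall y, 0 <= v y) ->
  (forall y, u y = l * walk_step u y) -> (forall y, v y = l * walk_step v y) ->
  u e = v e -> u = v.
Proof.
move=> rec.
suff le u' v' : (forall y, 0 <= u' y) -> (forall y, 0 <= v' y) ->
    (forall y, u' y = l * walk_step u' y) ->
    (forall y, v' y = l * walk_step v' y) ->
    u' e = v' e -> forall x, u' x <= v' x.
  move=> u0 v0 uh vh uv; apply/funext => x.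
  by apply/le_anti; rewrite !le.
move=> u0 v0 uh vh uv x.
pose m y := Num.min (u' y) (v' y).
have m0 y : 0 <= m y by rewrite le_min u0 v0.
have mh : forall y, m y = l * walk_step m y.
  apply: recurrent_superharmonic => // y; rewrite le_min {1}uh {1}vh.
  apply/andP; split; rewrite ler_pM2l//; apply: le_walk_step => z.
    by rewrite ge_min lexx.
  by rewrite ge_min lexx orbT.
have d0 y : 0 <= u' y - m y by rewrite subr_ge0 ge_min lexx.
have dh : forall y, u' y - m y = l * walk_step (fun z => u' z - m z) y.
  by move=> y; rewrite walk_stepB mulrBr -uh -mh.
have de : u' e - m e = 0 by rewrite /m uv minxx subrr.
have /eqP := harmonic_eq0 d0 dh de x.
by rewrite subr_eq0 => /eqP ->; rewrite ge_min lexx orbT.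
Qed.

End Green.

(** * Kernel limits at transient parameters *)

Lemma near_all_seq (T : eqType) (L : seq T) (P : T -> nat -> Prop) :
  (forall x, x \in L -> \forall n \near \oo, P x n) ->
  \forall n \near \oo, forall x, x \in L -> P x n.
Proof.
elim: L => [|x L IH] LP; first by apply: nearW.
have Px : \forall n \near \oo, P x n by apply: LP; rewrite mem_head.
have PL : \forall n \near \oo, forall y, y \in L -> P y n.
  by apply: IH => y yL; apply: LP; rewrite in_cons yL orbT.
near=> n => y; rewrite in_cons => /orP[/eqP ->|]; first by near: n.
by move: y; near: n.
Unshelve. all: by end_near. Qed.

Lemma iter_walk_step_le n g h x : (forall y, g y <= h y) ->
  iter n walk_step g x <= iter n walk_step h x.
Proof. by move=> gh; elim: n x => // n IH x; exact: le_walk_step. Qed.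

Lemma iter_walk_stepZ n c h x :
  iter n walk_step (fun y => c * h y) x = c * iter n walk_step h x.
Proof.
elim: n x => // n IH x; rewrite !iterS -walk_stepZ; exact: eq_walk_step.
Qed.

Lemma iter_walk_step_delta n x :
  iter n walk_step (fun y => (y == e)%:R) x = p n x e.
Proof.
elim: n x => [|n IH] x; first by rewrite transition0.
by rewrite transitionS /=; exact: eq_walk_step.
Qed.

Lemma lambda_harmonic_next l f : 0 < l -> lambda_harmonic mu l f <->
  forall x, f x = \sum_(z <- group_next x) (l * mu (x^-1 * z)%g) * f z.
Proof.
move=> l0; rewrite lambda_harmonic_gt0//.
have E x : \sum_(z <- group_next x) (l * mu (x^-1 * z)%g) * f z =
    l * walk_step f x.
  by rewrite big_map mulr_sumr; apply: eq_bigr => s _; rewrite mulKg mulrA.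
by split => fh x; rewrite [LHS]fh E.
Qed.

Section TransientLimit.
Context (l : R) (l0 : 0 < l) (tr : transient l) (h : Gamma -> R).
Context (h0 : forall x, 0 <= h x) (hh : forall x, h x = l * walk_step h x).

Let G := green_function mu l.

Let g y := G y e.

Let s (k : nat) y := Num.min (h y) (k%:R * g y).

Let psi k y := s k y - l * walk_step (s k) y.

Let g_gt0 y : 0 < g y. Proof. exact: green_function_gt0. Qed.

Let s_ge0 k y : 0 <= s k y.
Proof. by rewrite le_min h0 mulr_ge0// ltW. Qed.

Let g_super y : l * walk_step g y <= g y.
Proof. by rewrite /g /G [leRHS]green_functionE// lerDr. Qed.

Let psi_ge0 k y : 0 <= psi k y.
Proof.
rewrite subr_ge0 le_min; apply/andP; split.
  by rewrite hh ler_pM2l//; apply: le_walk_step => z; rewrite ge_min lexx.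
apply: (@le_trans _ _ (l * walk_step (fun z => k%:R * g z) y)).
  by rewrite ler_pM2l//; apply: le_walk_step => z; rewrite ge_min lexx orbT.
by rewrite walk_stepZ mulrCA ler_wpM2l.
Qed.

Let iter_g n x : l ^+ n * iter n walk_step g x = g x - green_sum l x e n.
Proof.
have := sum_iter_walk_step_defect l g n x.
have -> : (fun y => g y - l * walk_step g y) = fun y => (y == e)%:R.
  by apply/funext => y; rewrite /g /G [X in X - _]green_functionE// addrK.
under eq_bigr do rewrite iter_walk_step_delta.
by rewrite -[\sum_(_ <= _ < _) _]/(green_sum l x e n) => ->; ring.
Qed.

(** [s k] is dominated by a multiple of the potential [g], so that its
    harmonic part vanishes and it is the potential of its defect [psi k]. *)
Let sum_psi_cvg k x :
  \sum_(0 <= i < n) l ^+ i * iter i walk_step (psi k) x @[n --> \oo] --> s k x.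
Proof.
have tail : l ^+ n * iter n walk_step (s k) x @[n --> \oo] --> 0.
  have G0 : k%:R * (g x - green_sum l x e n) @[n --> \oo] --> k%:R * (g x - g x).
    by apply: cvgMl_tmp; apply: (cvgB (cvg_cst _)); exact: green_function_cvg.
  rewrite subrr mulr0 in G0; apply: (squeeze_cvgr _ (cvg_cst 0) G0).
  near=> n; rewrite mulr_ge0 ?exprn_ge0 ?(ltW l0) ?iter_walk_step_ge0//=.
  rewrite -iter_g mulrCA ler_pM2l ?exprn_gt0// -iter_walk_stepZ.
  by apply: iter_walk_step_le => y; rewrite ge_min lexx orbT.
rewrite (_ : (fun n => \sum_(0 <= i < n) _) =
    (fun n => s k x - l ^+ n * iter n walk_step (s k) x)); last first.
  by apply/funext => n; rewrite sum_iter_walk_step_defect.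
have : s k x - l ^+ n * iter n walk_step (s k) x @[n --> \oo] --> s k x - 0.
  by apply: (cvgB (cvg_cst _)).
by rewrite subr0.
Unshelve. all: by end_near. Qed.

Let sum_green_sum B x n f : \sum_(y <- B) green_sum l x y n * f y =
  \sum_(0 <= i < n) l ^+ i * \sum_(y <- B) p i x y * f y.
Proof.
under eq_bigr do rewrite mulr_suml; rewrite exchange_big; apply: eq_bigr => i _.
by rewrite mulr_sumr; apply: eq_bigr => y _; rewrite /green_term mulrA.
Qed.

Let sum_ball_le k x M : \sum_(y <- ball M) G x y * psi k y <= s k x.
Proof.
have H : \sum_(y <- ball M) green_sum l x y n * psi k y @[n --> \oo] -->
    \sum_(y <- ball M) G x y * psi k y.
  by apply: cvg_sum => y; apply: cvgMr_tmp; exact: green_function_cvg.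
apply: cvgr_to_le H _; apply: nearW => n; rewrite sum_green_sum.
apply: le_trans (superharmonic_sum_le l0 n x (s_ge0 k)).
apply: ler_sum => i _; rewrite ler_pM2l ?exprn_gt0//.
by apply: sum_transition_le => //; exact: ball_uniq.
Qed.

Let sum_ball_ge k x n M : (`|x| + n <= M)%N ->
  \sum_(0 <= i < n) l ^+ i * iter i walk_step (psi k) x <=
  \sum_(y <- ball M) G x y * psi k y.
Proof.
move=> xM; apply: (@le_trans _ _ (\sum_(y <- ball M) green_sum l x y n * psi k y)).
  rewrite sum_green_sum !big_nat; apply: ler_sum => i /andP[_ i_n].
  by rewrite sum_transition//; lia.
by apply: ler_sum => y _; rewrite ler_wpM2r// green_sum_le.
Qed.

Let s_eq y : \forall k \near \oo, s k y = h y.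
Proof.
near=> k; apply/min_idPl; rewrite -ler_pdivrMr//; near: k.
exact: nbhs_infty_ger.
Unshelve. all: by end_near. Qed.

Let psi_eq0 x : \forall k \near \oo, psi k x = 0.
Proof.
near=> k; rewrite /psi (_ : s k x = h x); last by near: k; exact: s_eq.
rewrite hh; apply/eqP; rewrite subr_eq0; apply/eqP; congr (_ * _).
apply: eq_big_seq => t; move: t; near: k; apply: near_all_seq => t _.
by near=> k; rewrite (_ : s k _ = h (x * t)%g)//; near: k; exact: s_eq.
Unshelve. all: by end_near. Qed.

Let ball_approx k : exists M, forall x, x \in ball k ->
  s k x - k.+1%:R^-1 <= \sum_(y <- ball M) G x y * psi k y.
Proof.
have : \forall M \near \oo, forall x, x \in ball k ->
    s k x - k.+1%:R^-1 <= \sum_(y <- ball M) G x y * psi k y.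
  apply: near_all_seq => x _.
  have [|n _ nP] := @cvgr_gt _ _ _ _ _ _ (@sum_psi_cvg k x) (s k x - k.+1%:R^-1).
    by rewrite ltrBlDr ltrDl invr_gt0.
  exists (`|x| + n)%N => // M /= xM.
  apply: (le_trans (ltW (nP n (leqnn n)))).
  exact: sum_ball_ge.
by move=> [M _ MP]; exists M; exact: MP (leqnn M).
Qed.

(** The functions [s k = min h (k g)] increase to [h] and are potentials;
    restricting their charges to large balls gives the finitely supported
    measures required. Near a given point [s k] eventually agrees with the
    harmonic function [h], so its charge leaves every finite set. *)
Lemma transient_kernel_limit : minimal_harmonic (lambda_harmonic mu l) e h ->
  kernel_limit (green_ratio mu l) h.
Proof.
move=> hmin; have [M MP] := boolp.choice ball_approx.
have G0 x y : 0 < G x y by exact: green_function_gt0.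
apply: (@minimal_kernel_limit _ _ (green_ratio mu l) _ _ h group_next
  (fun x z => l * mu (x^-1 * z)%g) (ball \o M)
  (fun k y => G e y * psi k y) _ _ _ _ _ _ _ hmin).
- by move=> f; exact: lambda_harmonic_next.
- by move=> x y; rewrite divr_ge0// ltW// G0.
- by move=> y; rewrite /green_ratio divff// gt_eqF// G0.
- by move=> k y; rewrite mulr_ge0// ltW.
- by move=> y; near=> k; rewrite (_ : psi k y = 0) ?mulr0//; near: k; exact: psi_eq0.
- move=> x; near=> k => y wy.
  have xy : (x == y) = false.
    apply/eqP => xy; move/eqP: wy; apply; rewrite (_ : psi k y = 0) ?mulr0// -xy.
    by near: k; exact: psi_eq0.
  rewrite big_map /green_ratio green_functionE// xy add0r mulr_sumr mulr_suml.
  by apply: eq_bigr => t _; rewrite mulKg -/(G _ _) !mulrA.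
- move=> x; apply: (@squeeze_cvgr _ _ _ _ (fun k => h x - k.+1%:R^-1) (cst (h x))).
  + near=> k; rewrite (eq_bigr (fun y => G x y * psi k y)); last first.
      by move=> y _; rewrite /green_ratio -/(G _ _) -/(G e y) mulrA divfK// gt_eqF// G0.
    have <- : s k x = h x by near: k; exact: s_eq.
    rewrite /= sum_ball_le andbT; apply: MP; rewrite mem_ball; near: k.
    exact: nbhs_infty_ge.
  + have : h x - k.+1%:R^-1 @[k --> \oo] --> h x - 0.
      by apply: (cvgB (cvg_cst _)); exact: cvg_harmonic.
    by rewrite subr0.
  + exact: cvg_cst.
Unshelve. all: by end_near. Qed.

End TransientLimit.

(** * The radius of convergence *)

Section Radius.

Let root n := p n e e `^ n%:R^-1.

Lemma mu_e_pow_le n : mu e ^+ n <= p n e e.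
Proof.
elim: n => [|n IH]; first by rewrite transition0 eqxx.
rewrite exprSr; apply: le_trans (transition_lazy n e e).
by rewrite ler_wpM2r.
Qed.

Lemma mu_e_le1 : mu e <= 1.
Proof.
by have := mu_e_pow_le 1; rewrite expr1 => /le_trans; apply; exact: transition_le1.
Qed.

Let root_ge0 n : 0 <= root n. Proof. exact: powR_ge0. Qed.

Let rootX n : (0 < n)%N -> root n ^+ n = p n e e.
Proof.
move=> n0; rewrite -powR_mulrn ?powR_ge0// -powRrM mulVf ?powRr1//.
by rewrite pnatr_eq0 -lt0n.
Qed.

Let root_le n c : (0 < n)%N -> 0 <= c -> (root n <= c) = (p n e e <= c ^+ n).
Proof. by move=> n0 c0; rewrite -rootX// ler_pXn2r ?nnegrE. Qed.

Let root_ge n : mu e <= root n.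
Proof.
case: n => [|n]; first by rewrite /root invr0 powRr0 mu_e_le1.
by rewrite -(@ler_pXn2r _ n.+1) ?nnegrE// rootX// mu_e_pow_le.
Qed.

Let root_le1 n : root n <= 1.
Proof.
case: n => [|n]; first by rewrite /root invr0 powRr0.
by rewrite root_le// expr1n transition_le1.
Qed.

Let limsup := limn_sup root.

Let limsupE : limsup = inf (range (sups root)).
Proof.
apply: limn_supE; exists 1; split => // M M1 n _.
by rewrite /= ger0_norm//; apply: le_trans (root_le1 n) (ltW M1).
Qed.

Let sups_ub n m : (n <= m)%N -> root m <= sups root n.
Proof.
move=> nm; apply: ub_le_sup; last by exists m.
by exists 1 => _ [k _ <-].
Qed.

Let limsup_ge : mu e <= limsup.
Proof.
rewrite limsupE; apply: lb_le_inf; first by exists (sups root 0), 0%N.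
by move=> _ [n _ <-]; apply: le_trans (root_ge n) (sups_ub (leqnn n)).
Qed.

Let limsup_gt0 : 0 < limsup.
Proof. exact: lt_le_trans mu_e_gt0 limsup_ge. Qed.

Lemma walk_radius_gt0 : 0 < walk_radius mu.
Proof. by rewrite invr_gt0; exact: limsup_gt0. Qed.

Lemma le_walk_radius l : 0 < l ->
  (forall n, l ^+ n * p n e e <= 1) -> l <= walk_radius mu.
Proof.
move=> l0 lp; rewrite -[l]invrK lef_pV2 ?posrE ?invr_gt0// -/limsup limsupE.
apply: (@le_trans _ _ (sups root 1)).
  apply: ge_inf; last by exists 1%N.
  by exists 0 => _ [n _ <-]; apply: le_trans (root_ge0 n) (sups_ub (leqnn n)).
apply: ge_sup; first by exists (root 1), 1%N.
move=> _ [n /= n1 <-]; rewrite root_le ?invr_ge0 ?(ltW l0)//.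
by rewrite exprVn -[leRHS]mulr1 ler_pdivlMl ?exprn_gt0.
Qed.

(** Iterating harmonicity bounds the weighted return probabilities by one. *)
Lemma harmonic_le_walk_radius l h : 0 < l -> (forall x, 0 <= h x) -> h e = 1 ->
  (forall x, h x = l * walk_step h x) -> l <= walk_radius mu.
Proof.
move=> l0 h0 he hh; apply: le_walk_radius => // n.
have hs y : l * walk_step h y <= h y by rewrite -hh.
rewrite -he; apply: (le_trans _ (superharmonic_iter_le l0 n e hs)).
by rewrite ler_pM2l ?exprn_gt0// -[leLHS]mulr1 -[in leLHS]he transition_le_iter.
Qed.

(** By the root test: past some [N] the terms of the Green series at [l] are
    below those of a geometric series of ratio [q < 1]. *)
Lemma transient_lt_walk_radius l : 0 < l -> l < walk_radius mu -> transient l.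
Proof.
move=> l0 lr; have ll : limsup < l^-1.
  by rewrite -[limsup]invrK ltf_pV2 ?posrE ?invr_gt0// limsup_gt0.
have [c /andP[Lc cl]] : exists c, limsup < c < l^-1.
  by exists ((limsup + l^-1) / 2); rewrite !midf_lt.
have c0 : 0 < c := lt_trans limsup_gt0 Lc.
have [N NP] : exists N, forall n, (N <= n)%N -> root n <= c.
  move: Lc; rewrite limsupE => /inf_lt -[|_ [N _ <-] Nc].
    by exists (sups root 0), 0%N.
  by exists N => n Nn; apply: le_trans (sups_ub Nn) (ltW Nc).
pose q := l * c; have q0 : 0 < q by rewrite mulr_gt0.
have q1 : q < 1 by rewrite /q mulrC -ltr_pdivlMr// div1r.
have q1' : 1 - q != 0 by rewrite gt_eqF// subr_gt0.
have term n : (0 < n)%N -> (N <= n)%N -> l ^+ n * p n e e <= q ^+ n.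
  move=> n0 /NP; rewrite root_le ?(ltW c0)// => pn.
  by rewrite exprMn ler_pM2l ?exprn_gt0.
(* Adding the geometric tail makes the sequence of bounds nonincreasing. *)
have bound n : green_sum l e e (n + N.+1) + q ^+ (n + N.+1) / (1 - q) <=
    green_sum l e e N.+1 + q ^+ N.+1 / (1 - q).
  elim: n => [|n IH]; first by rewrite add0n.
  apply: le_trans IH; rewrite addSn green_sumSr.
  have := @term (n + N.+1)%N; rewrite addnS => /(_ isT) T.
  have {}T : l ^+ (n + N).+1 * p (n + N).+1 e e <= q ^+ (n + N).+1 by apply: T; lia.
  have -> : q ^+ (n + N).+1 / (1 - q) = q ^+ (n + N).+1 + q ^+ (n + N).+2 / (1 - q).
    by rewrite [q ^+ (n + N).+2]exprS; field.
  lra.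
apply: (@nonneg_series_cvg _ (green_sum l e e N.+1 + q ^+ N.+1 / (1 - q))).
  by move=> n; exact: green_term_ge0.
move=> n; apply: le_trans (bound n); apply: (@le_trans _ _ (green_sum l e e (n + N.+1))).
  apply: (nondecreasing_series (u_ := green_term l e e) (P := xpredT) (m := 0%N)).
    by move=> i _ _; exact: green_term_ge0.
  exact: leq_addr.
by rewrite lerDl divr_ge0 ?exprn_ge0 ?subr_ge0 ?ltW.
Qed.

End Radius.

(** * Kernel limits at the radius *)

Local Notation rho := (walk_radius mu).

Let rho_gt0 : 0 < rho := walk_radius_gt0.

(** Partial sums are polynomials in the parameter, and bound the Green function
    from below as soon as the latter converges. *)
Lemma green_left_gt x y n c : c < green_sum rho x y n ->
  \forall t \near rho^'-, c < green_function mu t x y.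
Proof.
move=> cn.
have H : green_sum t x y n @[t --> rho^'-] --> green_sum rho x y n.
  apply: cvg_at_left_filter; apply: cvg_sum => i; apply: cvgMr_tmp.
  exact: exprn_continuous.
near=> t.
have t0 : 0 < t by near: t; exact: nbhs_left_gt.
have tr : transient t.
  by apply: transient_lt_walk_radius => //; near: t; exact: nbhs_left_lt.
apply: lt_le_trans (green_sum_le t0 tr x y n).
by near: t; exact: cvgr_gt H _ cn.
Unshelve. all: by end_near. Qed.

Lemma green_left_cvg x y : transient rho ->
  green_function mu t x y @[t --> rho^'-] --> green_function mu rho x y.
Proof.
move=> tr; apply/cvgrPdist_le => eps eps0.
have [n _ nP] : \forall n \near \oo,
    green_function mu rho x y - eps < green_sum rho x y n.
  apply: cvgr_gt (green_function_cvg rho_gt0 tr (x := x) (y := y)) _ _.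
  by rewrite ltrBlDr ltrDl.
near=> t.
have t0 : 0 < t by near: t; exact: nbhs_left_gt.
have tr0 : t < rho by near: t; exact: nbhs_left_lt.
have tP : green_function mu rho x y - eps < green_function mu t x y.
  by near: t; exact: green_left_gt (nP n (leqnn n)).
have trt := transient_lt_walk_radius t0 tr0.
have le : green_function mu t x y <= green_function mu rho x y.
  apply: cvgr_to_le (green_function_cvg t0 trt (x := x) (y := y)) _.
  apply: nearW => m; apply: (le_trans _ (green_sum_le rho_gt0 tr x y m)).
  apply: ler_sum => i _.
  by rewrite ler_wpM2r// lerXn2r ?nnegrE ?(ltW t0) ?(ltW rho_gt0) ?(ltW tr0).
by rewrite ler_norml; apply/andP; split; lra.
Unshelve. all: by end_near. Qed.

Lemma transient_radius_kernel x y : transient rho ->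
  lambda_kernel mu rho x y = green_ratio mu rho x y.
Proof.
move=> tr; rewrite /lambda_kernel gt_eqF// ltxx.
apply: cvg_lim; first exact: Rhausdorff.
apply: cvgM; first exact: green_left_cvg.
apply: cvgV; last exact: green_left_cvg.
by rewrite gt_eqF// green_function_gt0.
Qed.

Lemma green_left_infty x y (c : R) : ~ transient rho ->
  \forall t \near rho^'-, c < green_function mu t x y.
Proof.
move=> rec; suff [n cn] : exists n, c < green_sum rho x y n.
  exact: green_left_gt cn.
apply: contrapT => nex; apply: rec.
have [d d0 [k dk]] := green_sum_prolong rho_gt0 x x y.
apply: (@nonneg_series_cvg _ (d * c)) => [n|n]; first exact: green_term_ge0.
rewrite -[series _ _]/(green_sum rho e e n) -(green_sum_diag _ x).
apply: le_trans (dk n) _; rewrite ler_pM2l// leNgt.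
by apply/negP => cn; apply: nex; exists (n + k)%N.
Qed.

(** A limit point of the kernels as [t] tends to the radius is harmonic,
    because the Green function at the pole explodes, and nonnegative harmonic
    functions are unique up to scaling in the recurrent case. *)
Lemma recurrent_radius_kernel h : ~ transient rho -> (forall x, 0 <= h x) ->
  h e = 1 -> (forall x, h x = rho * walk_step h x) ->
  forall x y, lambda_kernel mu rho x y = h x.
Proof.
move=> rec h0 he hh x y; rewrite /lambda_kernel gt_eqF// ltxx.
apply: cvg_lim; first exact: Rhausdorff.
apply: ultrafilter_cvg => U UU rhoU.
have U_pos : U [set t | rho / 2 < t < rho].
  apply: rhoU; near=> t; apply/andP; split; near: t; last exact: nbhs_left_lt.
  by apply: nbhs_left_gt; rewrite ltr_pdivrMr// ltr_pMr// ltr1n.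
have half0 : 0 < rho / 2 by rewrite divr_gt0.
have U_tr t : rho / 2 < t < rho -> 0 < t /\ transient t.
  move=> /andP[t0 t1]; have t0' := lt_trans half0 t0.
  by split => //; exact: transient_lt_walk_radius.
have G0 t z : rho / 2 < t < rho -> 0 < green_function mu t z y.
  by move=> /U_tr[t0 tr]; exact: green_function_gt0.
have q_cvg z : exists l : R, green_ratio mu t z y @[t --> U] --> l.
  have pz : 0 < p `|z| e z by rewrite word_length_transition.
  apply: (@ultrafilter_bounded_cvg _ _ _ _ ((rho / 2) ^+ `|z| * p `|z| e z)^-1) => //.
  apply: filterS U_pos => t tP; have [t0 tr] := U_tr t tP.
  rewrite divr_ge0 ?(ltW (G0 t _ tP))//= ler_pdivrMr ?G0//.
  rewrite ler_pdivlMl ?mulr_gt0 ?exprn_gt0//.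
  have super w : t * walk_step (fun v => green_function mu t v y) w <=
      green_function mu t w y by rewrite [leRHS]green_functionE// lerDr.
  apply: (le_trans _ (superharmonic_iter_le t0 `|z| e super)).
  rewrite -mulrA; apply: ler_pM; rewrite ?exprn_ge0 ?(ltW half0)//.
  - by rewrite mulr_ge0// ltW// G0.
  - by rewrite lerXn2r ?nnegrE ?(ltW half0) ?(ltW t0)//; case/andP: tP => /ltW.
  - by apply: transition_le_iter => w; rewrite ltW// G0.
have [v vP] := boolp.choice q_cvg.
suff -> : h = v by exact: vP.
have v_e : v e = 1.
  apply: (@cvg_unique _ (@Rhausdorff R) _ _ _ _ (vP e)).
  apply: cvg_near_cst; apply: filterS U_pos => t tP.
  by rewrite /green_ratio divff// gt_eqF// G0.
apply: (recurrent_unique rho_gt0 rec) => //; last by rewrite v_e.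
- move=> z; apply: cvgr_to_ge (vP z) _; apply: filterS U_pos => t tP.
  by rewrite divr_ge0// ltW// G0.
move=> z; apply: (@cvg_unique _ (@Rhausdorff R) _ _ _ _ (vP z)).
have delta0 : (z == y)%:R / green_function mu t e y @[t --> U] --> (0 : R).
  apply/cvgrPdist_le => eps eps0; apply: rhoU.
  near=> t; rewrite sub0r normrN ger0_norm; last first.
    rewrite divr_ge0// ltW//; near: t.
    exact: green_left_infty.
  have Gt : eps^-1 < green_function mu t e y by near: t; exact: green_left_infty.
  have Gp : 0 < green_function mu t e y by apply: lt_trans Gt; rewrite invr_gt0.
  rewrite ler_pdivrMr//; apply: (@le_trans _ _ 1); first by rewrite lern1 leq_b1.
  by rewrite -ler_pdivrMl// mulr1 ltW.
have id_cvg : t @[t --> U] --> rho.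
  have H : t @[t --> rho^'-] --> rho by apply: cvg_at_left_filter; exact: cvg_id.
  by move=> A /H; exact: rhoU.
have step_cvg : walk_step (fun w => green_ratio mu t w y) z @[t --> U] -->
    walk_step v z.
  by apply: cvg_sum => s; apply: cvgMl_tmp; exact: vP.
have H : (z == y)%:R / green_function mu t e y +
    t * walk_step (fun w => green_ratio mu t w y) z @[t --> U] -->
    0 + rho * walk_step v z.
  by apply: cvgD => //; exact: cvgM.
move=> A; rewrite -[rho * _]add0r => /H HA.
have : U ([set t | rho / 2 < t < rho] `&` ((fun t =>
    (z == y)%:R / green_function mu t e y +
    t * walk_step (fun w => green_ratio mu t w y) z) @^-1` A)) by exact: filterI.
apply: (@filterS _ U) => t [/= tP At]; have [t0 tr] := U_tr t tP.
rewrite /preimage/= /green_ratio green_functionE// mulrDl -mulrA mulr_suml.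
rewrite (eq_bigr (fun s => mu s * green_ratio mu t (z * s)%g y))//.
by move=> s _; rewrite mulrA.
Unshelve. all: by end_near. Qed.

(** In the recurrent case the kernels do not depend on the pole, so any filter
    escaping to infinity will do; there is one because the group is infinite. *)
Lemma lambda_kernel_limit (Gamma_infinite : infinite_set [set: Gamma]) l h :
  0 <= l <= rho -> minimal_harmonic (lambda_harmonic mu l) e h ->
  kernel_limit (lambda_kernel mu l) h.
Proof.
move=> /andP[l0 lr] hmin; have [hh h0 he _] := hmin.
have [l00|lN] := eqVneq l 0.
  rewrite l00 in hmin *; have -> : lambda_kernel mu 0 = zero_kernel mu.
    by apply/funext => x; apply/funext => y; rewrite /lambda_kernel eqxx.
  exact: zero_kernel_limit.
have lp : 0 < l by rewrite lt_neqAle eq_sym lN.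
have hh' : forall x, h x = l * walk_step h x by apply/lambda_harmonic_gt0.
have [tr|rec] := pselect (transient l).
  have -> : lambda_kernel mu l = green_ratio mu l.
    apply/funext => x; apply/funext => y.
    move: lr; rewrite le_eqVlt => /orP[/eqP lE|lt].
      by rewrite lE transient_radius_kernel// -lE.
    by rewrite /lambda_kernel (negbTE lN) lt.
  exact: transient_kernel_limit.
have lE : l = rho.
  move: lr; rewrite le_eqVlt => /orP[/eqP//|lt].
  by case: rec; exact: transient_lt_walk_radius.
pose F : set_system Gamma := [set A | finite_set (~` A)].
have PF : ProperFilter F.
  split; first by rewrite /F /= setC0.
  split => //.
  - by rewrite /F /= setCT.
  - by move=> A B fA fB; rewrite /F /= setCI finite_setU.
  - by move=> A B AB; apply: sub_finite_set; exact: subsetC.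
exists F; split => // [y|x]; first by rewrite /F /= setCK.
rewrite lE in rec hh' *; apply: cvg_near_cst; apply: (@filterE _ F) => y.
exact: recurrent_radius_kernel.
Qed.

(** * The homeomorphism *)

Section Homeomorphism.
Context (Gamma_infinite : infinite_set [set: Gamma]).
Context (C : R -> compactification Gamma).
Context (C_martin : forall l : R, 0 <= l <= walk_radius mu ->
  is_martin_compactification (lambda_kernel mu l) (C l)).
Context (D : compactification (ST mu)).
Context (D_martin : is_martin_compactification (ST_kernel mu) D).

Let X : topologicalType := set_type (ST_minimal_boundary mu D).
Let Y : topologicalType := boundary_union_space mu C.

Let X_fun (eta : X) (q : ST mu) : R :=
  extension D (ST_kernel mu q) (set_val eta).

Let Y_fun (xi : Y) (q : ST mu) : R :=
  st_product (tag (set_val xi)) (rescaled_kernel mu (set_val xi)) q.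

Let X_fun_inj (eta zeta : X) : X_fun eta = X_fun zeta -> eta = zeta.
Proof.
move=> E; apply: val_inj.
have [e1 _] := set_valP eta; have [z1 _] := set_valP zeta.
apply: (martin_boundary_separated D_martin e1 z1) => q.
exact: (congr1 (fun f => f q) E).
Qed.

Let tag_ge0 (xi : Y) : 0 <= tag (set_val xi).
Proof. by have [/andP[]] := set_valP xi. Qed.

Let Y_fun_minimal (xi : Y) :
  minimal_harmonic (@ST_harmonic _ _ mu) (ST_base mu) (Y_fun xi).
Proof.
apply/minimal_rescaled_product; first exact: tag_ge0.
apply/minimal_lambda_rescaled; first exact: tag_ge0.
by have [_ []] := set_valP xi.
Qed.

Let Y_fun_tag (xi : Y) : Y_fun xi (ST_shift (ST_base mu)) = tag (set_val xi).
Proof.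
rewrite /Y_fun st_product_shift -[st_product _ _ _]/(Y_fun xi _).
by have [_ _ -> _] := Y_fun_minimal xi; rewrite mulr1.
Qed.

Let Y_fun_root (xi : Y) x :
  Y_fun xi (ST_root x) = rescaled_kernel mu (set_val xi) x.
Proof. exact: st_product_root. Qed.

Let Y_fun_inj (xi zeta : Y) : Y_fun xi = Y_fun zeta -> xi = zeta.
Proof.
move=> E; apply: val_inj.
have : rescaled_kernel mu (set_val xi) = rescaled_kernel mu (set_val zeta).
  by apply/funext => x; rewrite -!Y_fun_root E.
have : tag (set_val xi) = tag (set_val zeta) by rewrite -!Y_fun_tag E.
have [] := set_valP xi; have [] := set_valP zeta.
rewrite -!set_valE; case: (set_val xi) => l a; case: (set_val zeta) => l' b /=.
move=> _ [bb _] lr [ba _] ll'; move: lr b bb ba; rewrite -{}ll' => lr b bb ba kE.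
congr existT; apply: (martin_boundary_separated (C_martin lr)) => // x.
have := congr1 (fun f => f x) kE; rewrite /rescaled_kernel /=.
move/andP: lr => [l0 _]; exact/mulfI/lt0r_neq0/rescaling_gt0.
Qed.

Let Phi_ex (xi : Y) : exists eta : X, X_fun eta = Y_fun xi.
Proof.
have fmin := Y_fun_minimal xi.
have [eta etaD etaE] :=
  martin_boundary_of_kernel_limit D_martin (ST_kernel_limit fmin).
have etaE' : (fun q => extension D (ST_kernel mu q) eta) = Y_fun xi by exact/funext.
have etaX : ST_minimal_boundary mu D eta.
  by split => //; rewrite etaE'.
by exists (exist _ eta (mem_set etaX)); rewrite -etaE'.
Qed.

Let Psi_ex (eta : X) : exists xi : Y, Y_fun xi = X_fun eta.
Proof.
have [_ fmin] := set_valP eta.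
rewrite -[X in minimal_harmonic _ _ X]/(X_fun eta) in fmin.
have [l l0 fE] := ST_minimal_is_product fmin.
pose k := X_fun eta \o ST_root; pose h x := k x / rescaling mu l x.
have kE : k = fun x => rescaling mu l x * h x.
  by apply/funext => x; rewrite /h mulrC divfK// gt_eqF// rescaling_gt0.
have kmin : minimal_harmonic (rescaled_harmonic l) e k.
  by apply/minimal_rescaled_product => //; rewrite -fE.
have hmin : minimal_harmonic (lambda_harmonic mu l) e h.
  by apply/minimal_lambda_rescaled => //; rewrite -kE.
have lr : 0 <= l <= walk_radius mu.
  rewrite l0 /=; have [->|lN] := eqVneq l 0; first exact: ltW walk_radius_gt0.
  have lp : 0 < l by rewrite lt_neqAle eq_sym lN.
  have [hh h0 he _] := hmin.
  by apply: (harmonic_le_walk_radius lp h0 he); exact/lambda_harmonic_gt0.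
have [xi xiC xiE] := martin_boundary_of_kernel_limit (C_martin lr)
  (lambda_kernel_limit Gamma_infinite lr hmin).
have xiE' : (fun x => extension (C l) (lambda_kernel mu l x) xi) = h.
  exact/funext.
pose z : {l : R & C l} := existT (fun l => C l) l xi.
have xiY : boundary_union mu z.
  by split => //; split => //; rewrite /= xiE'.
exists (exist _ z (mem_set xiY)).
rewrite fE -/k kE -xiE'; exact/funext.
Qed.

Let tag_continuous : continuous (fun xi : Y => tag (set_val xi)).
Proof.
move=> xi; apply: (@continuous_comp Y _ R (boundary_union_map (C := C)) fst).
  exact: initial_continuous.
exact: cvg_fst.
Qed.

Let rescaled_kernel_continuous x :
  continuous (fun xi : Y => rescaled_kernel mu (set_val xi) x).
Proof.
move=> xi; apply: (@continuous_comp Y _ R (boundary_union_map (C := C))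
    (fun z => z.2 x)); first exact: initial_continuous.
apply: (@continuous_comp _ {ptws Gamma -> R} R snd (@^~ x)); first exact: cvg_snd.
exact: (@proj_continuous _ (fun=> R) x).
Qed.

Let X_fun_continuous q : continuous (fun eta : X => X_fun eta q).
Proof.
move=> eta; apply: (@continuous_comp X D R set_val (extension D (ST_kernel mu q))).
  exact: initial_continuous.
exact: extension_continuous.
Qed.

(** Both spaces are matched with the set of minimal space-time harmonic
    functions; in either direction the coordinates of one topology are
    continuous expressions in those of the other. *)
Lemma ST_minimal_boundary_homeomorphic : homeomorphic X Y.
Proof.
have [Phi PhiE] := boolp.choice Phi_ex; have [Psi PsiE] := boolp.choice Psi_ex.
exists Psi, Phi; split.
- by move=> eta; apply: X_fun_inj; rewrite PhiE PsiE.
- by move=> xi; apply: Y_fun_inj; rewrite PsiE PhiE.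
- apply: initial_topology_continuous.
  have c1 : continuous (fun eta => tag (set_val (Psi eta))).
    rewrite (_ : (fun eta => _) = fun eta => X_fun eta (ST_shift (ST_base mu))).
      exact: X_fun_continuous.
    by apply/funext => eta; rewrite -Y_fun_tag PsiE.
  have c2 : continuous (fun eta => (rescaled_kernel mu (set_val (Psi eta))
      : {ptws Gamma -> R})).
    apply: continuous_ptws => x.
    rewrite (_ : (fun eta => _) = fun eta => X_fun eta (ST_root x)).
      exact: X_fun_continuous.
    by apply/funext => eta; rewrite -Y_fun_root PsiE.
  move=> eta; have H := @cvg_pair _ _ _ (nbhs eta) _ _ _ _ _ _ _ (c1 eta) (c2 eta).
  exact: (H _ _ _).
- apply: initial_topology_continuous.
  apply: (continuous_to_martin_boundary D_martin) => [xi|q].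
    by have [] := set_valP (Phi xi).
  rewrite (_ : (fun xi => _) = fun xi => Y_fun xi q); last first.
    by apply/funext => xi; rewrite -PhiE.
  have tagX n : continuous (fun xi : Y => tag (set_val xi) ^+ n).
    move=> xi; apply: (@continuous_comp Y R R (fun xi => tag (set_val xi))
      (fun t => t ^+ n)); first exact: tag_continuous.
    exact: exprn_continuous.
  by move=> xi; exact: cvgM (tagX _ xi) (@rescaled_kernel_continuous _ xi).
Qed.

End Homeomorphism.

End Walk.

Theorem theorem6p7 (R : realType) (Gamma : groupType) (mu : Gamma -> R)
    (Gamma_countable : countable [set: Gamma])
    (Gamma_infinite : infinite_set [set: Gamma])
    (mu_probability : finitely_supported_probability mu)
    (mu_admissible : admissible mu)
    (mu_lazy : lazy mu)
    (C : R -> compactification Gamma)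
    (C_martin : forall l : R, 0 <= l <= walk_radius mu ->
       is_martin_compactification (lambda_kernel mu l) (C l))
    (D : compactification (ST mu))
    (D_martin : is_martin_compactification (ST_kernel mu) D) :
  homeomorphic (set_type (ST_minimal_boundary mu D))
    (boundary_union_space mu C).
Proof.
exact: (ST_minimal_boundary_homeomorphic mu_probability mu_admissible mu_lazy
  Gamma_infinite C_martin D_martin).
Qed.
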